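(* Let $\mathbf{\Sigma}\in\mathbb{R}^{d\times d}$ be symmetric PSD with eigenvalues $\lambda_1\ge\dots\ge\lambda_d$ and orthonormal eigenvectors $v_1,\dots,v_d$, let $\epsilon\in(0,1)$, $\lambda=(1+\frac{\epsilon}{100})\lambda_1$, $\mathbf{B}=\lambda\mathbf{I}-\mathbf{\Sigma}$, and let $c>0$ be a (sufficiently small) absolute constant. Let $x_0=x/\|x\|_2$ with $x\sim\mathcal{N}(0,\mathbf{I})$, and suppose we have a randomized subroutine $\mathrm{solve}(\cdot)$ such that for every input $y$, $$\mathbb{E}\|\mathrm{solve}(y)-\mathbf{B}^{-1}y\|_{\mathbf{B}}\le\frac{\epsilon^3}{3000\,d^{21}}\sqrt{\lambda_d(\mathbf{B}^{-1})}.$$ Then the procedure $x_t=\mathrm{solve}(x_{t-1})/\|\mathrm{solve}(x_{t-1})\|_2$ after $T=O(\log(d/\epsilon))$ iterations satisfies $\bar G(x_T)\le c\sqrt\epsilon$ with probability greater than $1-O(1/d^{10})$.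
   Context: $\lambda_i(\mathbf{B}^{-1})=1/(\lambda-\lambda_i)$ and $\|y\|_{\mathbf{B}}=\sqrt{y^\top\mathbf{B}y}$. Let $m$ be the number of eigenvalues of $\mathbf{\Sigma}$ that are $\ge(1-\epsilon/2)\lambda_1$, and let $\mathbf{V}_b$ have as columns the eigenvectors $v_{m+1},\dots,v_d$ (eigenvalues $<(1-\epsilon/2)\lambda_1$). With $\mathbf{P}_{\mathbf{V}_b}$ the orthogonal projection onto the column span of $\mathbf{V}_b$ and $\mathbf{P}_{v_1}$ onto $\mathrm{span}(v_1)$, define $\bar G(y)=\|\mathbf{P}_{\mathbf{V}_b}y\|_{\mathbf{B}}/\|\mathbf{P}_{v_1}y\|_{\mathbf{B}}$. *)

(* Defs.v *)
From HB Require Import structures.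
From mathcomp Require Import all_boot all_order all_algebra.
From mathcomp Require Import finmap.
From mathcomp Require Import all_classical all_reals all_analysis.

Set Implicit Arguments.
Unset Strict Implicit.
Unset Printing Implicit Defensive.

Import Order.TTheory GRing.Theory Num.Theory.
Import numFieldNormedType.Exports.

Local Open Scope classical_set_scope.
Local Open Scope ring_scope.

(* The sigma-algebra on matrices generated by the entries, that is, the Borel
   sigma-algebra of R^(m x n). *)
Section measurable_matrix.
Variables (R : realType) (m n : nat).

Definition matrix_measurable : set (set 'M[R]_(m, n)) :=
  <<s \bigcup_(ij in [set: 'I_m * 'I_n])
        preimage_set_system setT (fun A : 'M[R]_(m, n) => A ij.1 ij.2)
          measurable >>.

Let matrix_set0 : matrix_measurable set0.
Proof. exact: sigma_algebra0. Qed.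

Let matrix_setC A : matrix_measurable A -> matrix_measurable (~` A).
Proof. exact: sigma_algebraC. Qed.

Let matrix_bigcup (F : (set 'M[R]_(m, n))^nat) :
  (forall i, matrix_measurable (F i)) -> matrix_measurable (\bigcup_i (F i)).
Proof. exact: sigma_algebra_bigcup. Qed.

HB.instance Definition _ := @isMeasurable.Build default_measure_display
  'M[R]_(m, n) matrix_measurable matrix_set0 matrix_setC matrix_bigcup.

End measurable_matrix.

Section linear_algebra.
Variable R : realType.

Definition psd (d : nat) (A : 'M[R]_d) : Prop :=
  forall y : 'cV[R]_d, 0 <= (y^T *m A *m y) 0 0.

Definition norm2 (d : nat) (y : 'cV[R]_d) : R := Num.sqrt ((y^T *m y) 0 0).

Definition normalize (d : nat) (y : 'cV[R]_d) : 'cV[R]_d := (norm2 y)^-1 *: y.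

Definition mxnorm (d : nat) (B : 'M[R]_d) (y : 'cV[R]_d) : R :=
  Num.sqrt ((y^T *m B *m y) 0 0).

(* [v] is an orthonormal basis of eigenvectors of [Sigma], and [lam] lists the
   eigenvalues with multiplicity, in nonincreasing order; index [i] stands for
   the mathematical index i + 1. *)
Definition eigensystem (d : nat) (Sigma : 'M[R]_d) (lam : 'I_d -> R)
    (v : 'I_d -> 'cV[R]_d) : Prop :=
  [/\ forall i j : 'I_d, (i <= j)%N -> lam j <= lam i,
      forall i j : 'I_d, ((v i)^T *m v j) 0 0 = (i == j)%:R &
      forall i : 'I_d, Sigma *m v i = lam i *: v i].

(* Orthogonal projection onto the column span of [V], for a matrix [V] with
   linearly independent columns. *)
Definition orthoproj (d k : nat) (V : 'M[R]_(d, k)) : 'M[R]_d :=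
  V *m invmx (V^T *m V) *m V^T.

Definition shift (d : nat) (eps : R) (lam : 'I_d.+1 -> R) : R :=
  (1 + eps / 100) * lam ord0.

Definition shifted_mx (d : nat) (eps : R) (lam : 'I_d.+1 -> R)
    (Sigma : 'M[R]_d.+1) : 'M[R]_d.+1 := (shift eps lam)%:M - Sigma.

(* lambda_i (B^-1) = 1 / (lambda - lambda_i), which is nonincreasing in [i]. *)
Definition eig_inv (d : nat) (eps : R) (lam : 'I_d.+1 -> R) (i : 'I_d.+1) : R :=
  (shift eps lam - lam i)^-1.

Definition num_large (d : nat) (eps : R) (lam : 'I_d.+1 -> R) : nat :=
  #|[pred i : 'I_d.+1 | (1 - eps / 2) * lam ord0 <= lam i]|.

(* The columns of [bottom_mx] are v_(m+1), ..., v_d, with m = [num_large]. *)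
Definition bottom_mx (d : nat) (eps : R) (lam : 'I_d.+1 -> R)
    (v : 'I_d.+1 -> 'cV[R]_d.+1) :
    'M[R]_(d.+1, d.+1 - num_large eps lam) :=
  \matrix_(i, j) v (inord (num_large eps lam + j)) i 0.

(* The ratio is given the value +oo when its denominator vanishes, because the
   convention x / 0 = 0 would make every upper bound on it hold there. *)
Definition Gbar (d : nat) (eps : R) (lam : 'I_d.+1 -> R)
    (v : 'I_d.+1 -> 'cV[R]_d.+1) (B : 'M[R]_d.+1) (y : 'cV[R]_d.+1) : \bar R :=
  let num := mxnorm B (orthoproj (bottom_mx eps lam v) *m y) in
  let den := mxnorm B (orthoproj (v ord0) *m y) in
  if den == 0 then +oo%E else (num / den)%:E.

End linear_algebra.

Section probability.
Context {dO : measure_display} {Omega : measurableType dO} {R : realType}.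
Variable P : probability Omega R.

Definition mutually_independent (I : choiceType) (F : I -> set (set Omega)) :
    Prop :=
  forall (J : {fset I}) (A : I -> set Omega),
    (forall i, i \in J -> F i (A i)) ->
    P (\bigcap_(i in [set` J]) A i) = (\prod_(i <- J) fine (P (A i)))%:E.

Definition sigma_of {dT : measure_display} {T : measurableType dT}
    (X : Omega -> T) : set (set Omega) := preimage_set_system setT X measurable.

Definition standard_gaussian (d : nat) (X : Omega -> 'cV[R]_d) : Prop :=
  mutually_independent (fun i : 'I_d => sigma_of (fun w => X w i 0)) /\
  (forall (i : 'I_d) (A : set R), measurable A ->
     P ((fun w => X w i 0) @^-1` A) = normal_prob 0 1 A).

(* [X] and all the [seed t] are mutually independent, each [seed t] having
   law [Q]. *)
Definition independent_seeds {dX dS : measure_display} {TX : measurableType dX}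
    {S : measurableType dS} (Q : probability S R)
    (X : {RV P >-> TX}) (seed : nat -> {RV P >-> S}) : Prop :=
  mutually_independent
    (fun o : option nat => if o is Some t then sigma_of (seed t)
                           else sigma_of X) /\
  (forall (t : nat) (A : set S), measurable A ->
     distribution P (seed t) A = Q A).

End probability.

(* A randomized subroutine is a map of its input and of a random seed; each
   call to it consumes a fresh seed. *)
Fixpoint power_iterates (R : realType) (d : nat) (S : Type)
    (solve : 'cV[R]_d -> S -> 'cV[R]_d) (x0 : 'cV[R]_d) (seed : nat -> S)
    (t : nat) : 'cV[R]_d :=
  if t is t'.+1
  then normalize (solve (power_iterates solve x0 seed t') (seed t'))
  else x0.

(* Main.v *)
Require Import Defs.
From HB Require Import structures.
From mathcomp Require Import all_boot all_order all_algebra.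
From mathcomp Require Import finmap.
From mathcomp Require Import all_classical all_reals all_analysis.
From mathcomp Require Import measurable_realfun.
From mathcomp Require Import ring lra.

Set Implicit Arguments.
Unset Strict Implicit.
Unset Printing Implicit Defensive.

Import Order.TTheory GRing.Theory Num.Theory.
Import numFieldNormedType.Exports.

Local Open Scope classical_set_scope.
Local Open Scope ring_scope.

(* In the eigenbasis of Sigma, with weights w_i = lambda - lambda_i, one exact
   step divides the i-th coordinate by w_i, and every bottom weight is at least
   51 w_1.  A step with error h / sqrt(w_1) in the B-norm therefore turns a
   ratio Gbar^2 = g into at most g / 100 + 8 (h / a)^2 and decreases the
   coordinate a along v_1 of the unit iterate by at most 2 h, so O(log(d / eps))
   steps succeed as long as T h is small compared with the initial a.

   Initially a >= d^-10 / sqrt(30 d ln d) outside an event of probability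
   O(d^-10): P(|<v_1, x>| <= delta) = O(delta) follows from the value of
   E exp(-t <v_1, x>^2), computed one Gaussian coordinate at a time, and the
   entries of x have Gaussian tails.  Since the t-th seed is independent of the
   t-th iterate, Fubini and Markov bound every error by T d^10 times its mean
   outside an event of probability 1 / (T d^10); this gives
   h = T eps^3 / (3000 d^11), which is smaller than a by a factor sqrt(d) up to
   logarithms.  Small dimensions are absorbed in the constant K2. *)

(** * One inexact inverse step in eigencoordinates: weights [w], input [z], error [e], output [y] *)

Section perturbed_step.
Variables (R : realFieldType) (n : nat) (w z e : 'I_n.+1 -> R).
Variables (bot : pred 'I_n.+1) (h : R).
Hypotheses (w0_gt0 : 0 < w ord0) (w_ge : forall i, w ord0 <= w i).
Hypothesis bot_w : forall i, bot i -> 51 * w ord0 <= w i.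
Hypotheses (h_gt0 : 0 < h) (z1 : \sum_i z i ^+ 2 = 1).
Hypothesis e_le : \sum_i w i * e i ^+ 2 <= h ^+ 2 / w ord0.
Let y i := z i / w i + e i.

Let w_gt0 i : 0 < w i. Proof. exact: lt_le_trans (w_ge i). Qed.
Let w_ge0 i : 0 <= w i. Proof. exact: ltW. Qed.
Let h_ge0 : 0 <= h. Proof. exact: ltW. Qed.

(** Keeping only the head term of the weighted error bound gives [|e ord0| <= h / w ord0]; the
    reverse triangle inequality does the rest. *)
Lemma perturbed_head_ge : (`|z ord0| - h) / w ord0 <= `|y ord0|.
Proof.
have e0 : w ord0 * e ord0 ^+ 2 <= h ^+ 2 / w ord0.
  apply: le_trans e_le; rewrite (bigD1 ord0)//= lerDl sumr_ge0// => i _.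
  by rewrite mulr_ge0 ?sqr_ge0.
have {}e0 : `|e ord0| <= h / w ord0.
  rewrite -(@ler_pXn2r _ 2)// ?nnegrE ?divr_ge0//.
  rewrite real_normK ?num_real// expr_div_n ler_pdivlMr ?exprn_gt0//.
  by move: e0; rewrite ler_pdivlMr//; lra.
have := lerB_normD (z ord0 / w ord0) (e ord0).
rewrite normrM normfV (gtr0_norm w0_gt0) /y mulrBl; lra.
Qed.

(** This is the triangle inequality in squared form: as every weight is at least [w ord0], the exact
    part has norm at most [1 / w ord0] and the error at most [h / w ord0]. *)
Lemma perturbed_norm_le : \sum_i y i ^+ 2 <= ((1 + h) / w ord0) ^+ 2.
Proof.
have -> : ((1 + h) / w ord0) ^+ 2 = (1 + h) / w ord0 ^+ 2 * 1 +
     (1 + h^-1) / w ord0 * (h ^+ 2 / w ord0).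
  by field; rewrite !gt_eqF.
have c0 : 0 <= (1 + h^-1) / w ord0.
  by rewrite divr_ge0 ?addr_ge0 ?invr_ge0.
apply: le_trans (lerD (lexx _) (ler_wpM2l c0 e_le)).
rewrite -[X in _ * X + _]z1 !mulr_sumr -big_split ler_sum//= => i _.
(* weighted AM-GM with weight [h] on the exact part, the only choice giving the
   sharp factor [(1 + h) ^+ 2] *)
have am : y i ^+ 2 <= (1 + h) * (z i / w i) ^+ 2 + (1 + h^-1) * e i ^+ 2.
  rewrite -subr_ge0 /y [leRHS](_ : _ = (h * (z i / w i) - e i) ^+ 2 / h).
    by rewrite divr_ge0 ?sqr_ge0.
  by field; rewrite !gt_eqF.
apply: (le_trans am); apply: lerD.
  rewrite expr_div_n [leLHS]mulrA mulrAC ler_wpM2r ?sqr_ge0//.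
  rewrite ler_wpM2l ?lef_pV2 ?posrE ?exprn_gt0 ?addr_ge0//.
  by rewrite ler_pXn2r ?nnegrE.
rewrite -mulrA ler_wpM2l ?addr_ge0 ?invr_ge0//.
rewrite mulrA ler_peMl ?sqr_ge0// mulrC ler_pdivlMr// mul1r//.
Qed.

(** The factors 2 come from [(u + e) ^+ 2 <= 2 * u ^+ 2 + 2 * e ^+ 2]; on bottom indices the exact
    part shrinks by [w i >= 51 * w ord0]. *)
Lemma perturbed_bottom_le : \sum_(i | bot i) w i * y i ^+ 2 <=
  2 / (51 * w ord0) ^+ 2 * (\sum_(i | bot i) w i * z i ^+ 2) +
  2 * (h ^+ 2 / w ord0).
Proof.
have eb : \sum_(i | bot i) w i * e i ^+ 2 <= h ^+ 2 / w ord0.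
  apply: le_trans e_le; rewrite [leRHS](bigID bot)/= lerDl sumr_ge0// => i _.
  by rewrite mulr_ge0 ?sqr_ge0.
apply: le_trans (lerD (lexx _) (ler_wpM2l _ eb)); last by [].
rewrite !mulr_sumr -big_split ler_sum//= => i bi.
have am : y i ^+ 2 <= 2 * (z i / w i) ^+ 2 + 2 * e i ^+ 2.
  by rewrite -subr_ge0 /y [leRHS](_ : _ = (z i / w i - e i) ^+ 2) ?sqr_ge0//; ring.
apply: (le_trans (ler_wpM2l (ltW (w_gt0 i)) am)).
rewrite mulrDr; apply: lerD; last by rewrite mulrCA.
rewrite expr_div_n [leLHS](_ : _ = 2 / w i ^+ 2 * (w i * z i ^+ 2)); last by ring.
rewrite ler_wpM2r ?(mulr_ge0 (w_ge0 i) (sqr_ge0 _))//.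
rewrite ler_wpM2l// lef_pV2 ?posrE ?exprn_gt0 ?mulr_gt0//.
by rewrite ler_pXn2r ?nnegrE ?bot_w// ?mulr_ge0.
Qed.

(** Since [h <= a / 2], the head keeps half of its exact value, so that [w ord0 * y ord0 ^+ 2 >= z
    ord0 ^+ 2 / (4 * w ord0)]. Dividing the bottom bound by this gives the factors
    [4 * 2 / 51 ^+ 2 <= 1 / 100] on [g] and [4 * 2 = 8] on the error. *)
Lemma perturbed_ratio_le (a g : R) : 0 < a -> h <= a / 2 ->
  a <= `|z ord0| -> 0 <= g ->
  \sum_(i | bot i) w i * z i ^+ 2 <= g * (w ord0 * z ord0 ^+ 2) ->
  \sum_(i | bot i) w i * y i ^+ 2 <=
    (g / 100 + 8 * (h / a) ^+ 2) * (w ord0 * y ord0 ^+ 2).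
Proof.
move=> a0 ha az g0 zb; have a_ge0 := ltW a0; apply: (le_trans perturbed_bottom_le).
have y0 : z ord0 ^+ 2 / (4 * w ord0) <= w ord0 * y ord0 ^+ 2.
  have zh : `|z ord0| / 2 / w ord0 <= `|y ord0|.
    apply: le_trans perturbed_head_ge.
    by rewrite ler_wpM2r ?invr_ge0//; lra.
  rewrite -[y _ ^+ 2]real_normK ?num_real//.
  have /(ler_wpM2l (ltW w0_gt0)) : (`|z ord0| / 2 / w ord0) ^+ 2 <= `|y ord0| ^+ 2.
    by rewrite ler_pXn2r ?nnegrE ?divr_ge0.
  apply: le_trans; rewrite !exprMn real_normK ?num_real// le_eqVlt.
  by apply/orP; left; apply/eqP; field; rewrite gt_eqF.
have g'0 : 0 <= g / 100 + 8 * (h / a) ^+ 2.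
  by rewrite addr_ge0// ?divr_ge0// (mulr_ge0 _ (sqr_ge0 _)).
apply: le_trans (ler_wpM2l g'0 y0); rewrite [leRHS]mulrDl; apply: lerD.
  have c0 : 0 <= 2 / (51 * w ord0) ^+ 2 by rewrite divr_ge0 ?sqr_ge0.
  apply: (le_trans (ler_wpM2l c0 zb)).
  have -> : 2 / (51 * w ord0) ^+ 2 * (g * (w ord0 * z ord0 ^+ 2)) =
      2 / 2601 * (g * z ord0 ^+ 2 / w ord0) by field; rewrite gt_eqF.
  have -> : g / 100 * (z ord0 ^+ 2 / (4 * w ord0)) =
      1 / 400 * (g * z ord0 ^+ 2 / w ord0) by field; rewrite gt_eqF.
  by rewrite ler_wpM2r ?divr_ge0 ?(mulr_ge0 g0 (sqr_ge0 _))//; lra.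
have -> : 8 * (h / a) ^+ 2 * (z ord0 ^+ 2 / (4 * w ord0)) =
   2 * (h ^+ 2 / w ord0) * (z ord0 ^+ 2 / a ^+ 2).
  by field; rewrite !gt_eqF.
(* The remaining factor [z ord0 ^+ 2 / a ^+ 2] is at least 1 because [a] bounds the head from
   below. *)
rewrite ler_peMr ?(mulr_ge0 _ (divr_ge0 (sqr_ge0 _) _))//.
rewrite ler_pdivlMr ?exprn_gt0// mul1r -[leRHS]real_normK ?num_real//.
by rewrite ler_pXn2r ?nnegrE.
Qed.

End perturbed_step.

(** * Eigencoordinates, the B-norm, the two projections and the invariant of the iteration *)

Section eigenbasis.
Variables (R : realType) (n : nat).
Variables (Sigma : 'M[R]_n.+1) (lam : 'I_n.+1 -> R) (v : 'I_n.+1 -> 'cV[R]_n.+1).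
Variable eps : R.
Hypotheses (eps_gt0 : 0 < eps) (lam0_gt0 : 0 < lam ord0).
Hypotheses (Sigma_sym : Sigma^T = Sigma) (eig : eigensystem Sigma lam v).

Definition eigcoord (i : 'I_n.+1) (y : 'cV[R]_n.+1) : R := ((v i)^T *m y) 0 0.
(** The eigenvalue of [B] at [v i], which plays the part of the weight [w i] of the one-step
    estimates. *)
Definition gap (i : 'I_n.+1) : R := Defs.shift eps lam - lam i.
Let B := shifted_mx eps lam Sigma.
Let m := num_large eps lam.

Lemma gap_head : gap ord0 = eps / 100 * lam ord0.
Proof. by rewrite /gap /Defs.shift; ring. Qed.

Lemma gap_head_gt0 : 0 < gap ord0.
Proof. by rewrite gap_head mulr_gt0 ?divr_gt0. Qed.

Lemma gap_head_le i : gap ord0 <= gap i.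
Proof. by case: eig => lamS _ _; rewrite /gap lerD2l lerN2 lamS. Qed.

Lemma gap_gt0 i : 0 < gap i.
Proof. exact: lt_le_trans gap_head_gt0 (gap_head_le i). Qed.

Lemma eigcoordD i y z : eigcoord i (y + z) = eigcoord i y + eigcoord i z.
Proof. by rewrite /eigcoord mulmxDr mxE. Qed.

Lemma eigcoordZ i a y : eigcoord i (a *: y) = a * eigcoord i y.
Proof. by rewrite /eigcoord -scalemxAr mxE. Qed.

Lemma eigcoord_sum i (I : Type) (r : seq I) (F : I -> 'cV_n.+1) :
  eigcoord i (\sum_(j <- r) F j) = \sum_(j <- r) eigcoord i (F j).
Proof. by rewrite /eigcoord mulmx_sumr summxE. Qed.

Lemma eigcoord_basis i j : eigcoord i (v j) = (i == j)%:R.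
Proof. by case: eig => _ vv _; exact: vv. Qed.

Let V := \matrix_(i, j) v j i 0.

Let trV_mulV : V^T *m V = 1%:M.
Proof.
apply/matrixP => i j; rewrite mxE [RHS]mxE -(eigcoord_basis i j) /eigcoord mxE.
by apply: eq_bigr => k _; rewrite !mxE.
Qed.

Let V_mul_trV : V *m V^T = 1%:M. Proof. exact: mulmx1C. Qed.

(** Completeness of the eigenvectors: [V] is square, so its left inverse [V^T] is also a right
    inverse. *)
Lemma eigcoord_decomp y : y = \sum_i eigcoord i y *: v i.
Proof.
rewrite -[LHS]mul1mx -V_mul_trV -mulmxA; apply/colP => k.
rewrite mxE summxE; apply: eq_bigr => i _; rewrite !mxE mulrC; congr (_ * _).
by rewrite /eigcoord mxE; apply: eq_bigr => j _; rewrite !mxE.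
Qed.

(** Only the right-hand [y] is expanded, so no double sum appears. Taking [A] to be the identity or
    [B] yields the Euclidean norm and the B-norm. *)
Lemma quadratic_form_eigcoord (A : 'M[R]_n.+1) (a : 'I_n.+1 -> R) y :
  (forall i, A *m v i = a i *: v i) ->
  (y^T *m A *m y) 0 0 = \sum_i a i * eigcoord i y ^+ 2.
Proof.
move=> Av; rewrite {2}(eigcoord_decomp y) mulmx_sumr summxE; apply: eq_bigr => i _.
have yv : (y^T *m v i) 0 0 = eigcoord i y.
  by rewrite /eigcoord mxE [RHS]mxE; apply: eq_bigr => j _; rewrite !mxE mulrC.
rewrite -scalemxAr -mulmxA Av -scalemxAr scalerA mxE yv.
ring.
Qed.

Lemma norm2_eigcoord y : norm2 y ^+ 2 = \sum_i eigcoord i y ^+ 2.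
Proof.
have q : (y^T *m y) 0 0 = \sum_i eigcoord i y ^+ 2.
  rewrite -[y^T]mulmx1 (@quadratic_form_eigcoord _ (fun=> 1)).
    by apply: eq_bigr => i _; rewrite mul1r.
  by move=> i; rewrite mul1mx scale1r.
by rewrite /norm2 q sqr_sqrtr// sumr_ge0// => i _; exact: sqr_ge0.
Qed.

Lemma shifted_mx_basis i : B *m v i = gap i *: v i.
Proof.
case: eig => _ _ Sv.
by rewrite /B /shifted_mx mulmxBl mul_scalar_mx Sv scalerBl.
Qed.

Lemma mxnorm_eigcoord y : mxnorm B y ^+ 2 = \sum_i gap i * eigcoord i y ^+ 2.
Proof.
rewrite /mxnorm (quadratic_form_eigcoord y shifted_mx_basis) sqr_sqrtr//.
by rewrite sumr_ge0// => i _; rewrite mulr_ge0 ?sqr_ge0 ?ltW ?gap_gt0.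
Qed.

(** [B] is the product of [V], the diagonal matrix of the positive gaps, and [V^T], all
    invertible. *)
Lemma shifted_mx_unit : B \in unitmx.
Proof.
have BV : B *m V = V *m diag_mx (\row_i gap i).
  apply/matrixP => i j; have /colP/(_ i) := shifted_mx_basis j.
  rewrite mul_mx_diag !mxE [in RHS]mulrC => <-.
  by apply: eq_bigr => k _; rewrite !mxE.
have [Vu _] := mulmx1_unit V_mul_trV.
rewrite -(mulmx1 B) -V_mul_trV mulmxA BV !unitmx_mul unitmx_tr Vu andbT /=.
rewrite unitmxE det_diag unitfE; apply/prodf_neq0 => i _.
by rewrite mxE gt_eqF ?gap_gt0.
Qed.

Lemma eigcoord_shifted_mx i y : eigcoord i (B *m y) = gap i * eigcoord i y.
Proof.
have trB : B^T = B by rewrite /B /shifted_mx linearB /= tr_scalar_mx Sigma_sym.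
rewrite /eigcoord mulmxA -[(v i)^T *m B]trmxK trmx_mul trmxK trB shifted_mx_basis.
by rewrite linearZ /= -scalemxAl mxE.
Qed.

Lemma eigcoord_inv_shifted_mx i y : eigcoord i (invmx B *m y) = eigcoord i y / gap i.
Proof.
rewrite -{2}(mulKVmx shifted_mx_unit y) eigcoord_shifted_mx mulrC mulKf//.
by rewrite gt_eqF ?gap_gt0.
Qed.

(** If [lam i] reached the threshold, so would the eigenvalues at all [i + 1] indices up to [i], by
    monotonicity, and the count [m] would exceed [i]. *)
Lemma lam_bottom_lt (i : 'I_n.+1) : (m <= i)%N -> lam i < (1 - eps / 2) * lam ord0.
Proof.
case: eig => lamS _ _.
move=> mi; rewrite ltNge; apply/negP => li; move: mi; apply/negP; rewrite -ltnNge.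
have winj : injective (widen_ord (ltn_ord i)).
  by move=> x y /(congr1 val) /= xy; exact: val_inj.
rewrite -[X in (X <= _)%N]card_ord -(card_codom winj) subset_leq_card//.
apply/fintype.subsetP => j /codomP[k ->]; rewrite inE /= (le_trans li)// lamS//=.
by rewrite -ltnS ltn_ord.
Qed.

(** The constant is [(1 / 100 + 1 / 2) / (1 / 100) = 51]. *)
Lemma gap_bottom_ge (i : 'I_n.+1) : (m <= i)%N -> 51 * gap ord0 <= gap i.
Proof. by move/lam_bottom_lt; rewrite gap_head /gap /Defs.shift; lra. Qed.

Lemma eigcoord_orthoproj_bottom i y :
  eigcoord i (orthoproj (bottom_mx eps lam v) *m y) =
  if (m <= i)%N then eigcoord i y else 0.
Proof.
(* The index stays in range, so the [inord] in [bottom_mx] never takes its default value. *)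
have mo (j : 'I_(n.+1 - m)) : (m + j < n.+1)%N.
  by rewrite -ltn_subRL ltn_ord.
set Vb := bottom_mx eps lam v.
have VbE j k : Vb k j = v (inord (m + j)) k 0 by rewrite mxE.
have VbVb : Vb^T *m Vb = 1%:M.
  apply/matrixP => j k; rewrite mxE [RHS]mxE.
  have -> : (j == k) = (inord (m + j) == inord (m + k) :> 'I_n.+1).
    by rewrite -!val_eqE /= !inordK ?mo// eqn_add2l.
  rewrite -eigcoord_basis /eigcoord mxE; apply: eq_bigr => l _.
  by rewrite !mxE.
(* The columns are orthonormal, so the Gram matrix in [orthoproj] disappears. *)
rewrite /orthoproj VbVb invmx1 mulmx1 -mulmxA.
have -> : Vb *m (Vb^T *m y) =
    \sum_(j < n.+1 - m) eigcoord (inord (m + j)) y *: v (inord (m + j)).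
  apply/colP => k; rewrite mxE summxE; apply: eq_bigr => j _.
  rewrite VbE !mxE mulrC; congr (_ * _); rewrite /eigcoord mxE; apply: eq_bigr => l _.
  by rewrite !mxE.
rewrite eigcoord_sum.
under eq_bigr do rewrite eigcoordZ eigcoord_basis.
case: ifPn => [mi|mi].
  (* A bottom vector [v i] is the column of index [i - m]. *)
  have im : (i - m < n.+1 - m)%N by rewrite ltn_sub2r// (leq_ltn_trans mi).
  rewrite (bigD1 (Ordinal im))//= subnKC// inord_val eqxx mulr1 big1 ?addr0// => j.
  rewrite -val_eqE /= => ji; rewrite [i == _](_ : _ = false) ?mulr0//.
  apply/negbTE; apply: contra ji => /eqP ->; rewrite inordK ?mo//.
  by rewrite addKn.
rewrite big1// => j _; rewrite [i == _](_ : _ = false) ?mulr0//.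
by apply/negbTE; apply: contra mi => /eqP ->; rewrite inordK ?mo// leq_addr.
Qed.

Lemma eigcoord_orthoproj_head i y :
  eigcoord i (orthoproj (v ord0) *m y) = (i == ord0)%:R * eigcoord ord0 y.
Proof.
have -> : orthoproj (v ord0) *m y = eigcoord ord0 y *: v ord0.
  have v1 : (v ord0)^T *m v ord0 = 1%:M.
    by apply/matrixP => j k; rewrite !ord1 [LHS]eigcoord_basis mxE.
  rewrite /orthoproj v1 invmx1 mulmx1 -mulmxA [_^T *m y]mx11_scalar.
  by rewrite mul_mx_scalar.
by rewrite eigcoordZ eigcoord_basis mulrC.
Qed.

Lemma mxnorm_orthoproj_bottom y :
  mxnorm B (orthoproj (bottom_mx eps lam v) *m y) ^+ 2 =
  \sum_(i < n.+1 | (m <= i)%N) gap i * eigcoord i y ^+ 2.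
Proof.
rewrite mxnorm_eigcoord [RHS]big_mkcond; apply: eq_bigr => i _.
by rewrite eigcoord_orthoproj_bottom; case: ifP => //; rewrite expr0n mulr0.
Qed.

Lemma mxnorm_orthoproj_head y :
  mxnorm B (orthoproj (v ord0) *m y) ^+ 2 = gap ord0 * eigcoord ord0 y ^+ 2.
Proof.
rewrite mxnorm_eigcoord (bigD1 ord0)//= big1 ?addr0 => [|i /negbTE i0].
  by rewrite eigcoord_orthoproj_head mul1r.
by rewrite eigcoord_orthoproj_head i0 mul0r expr0n mulr0.
Qed.

(** A nonzero head coordinate excludes the branch of value [+oo]; the squared inequality is then the
    bound on the quotient with its denominator cleared. *)
Lemma Gbar_le (r : R) y : 0 <= r -> eigcoord ord0 y != 0 ->
  \sum_(i < n.+1 | (m <= i)%N) gap i * eigcoord i y ^+ 2 <=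
    r ^+ 2 * (gap ord0 * eigcoord ord0 y ^+ 2) ->
  (Gbar eps lam v B y <= r%:E)%E.
Proof.
move=> r0 y0; rewrite -mxnorm_orthoproj_bottom -mxnorm_orthoproj_head -exprMn.
have d0 : mxnorm B (orthoproj (v ord0) *m y) != 0.
  rewrite -sqrf_eq0 mxnorm_orthoproj_head.
  by rewrite mulf_neq0 ?expf_neq0 ?(gt_eqF gap_head_gt0).
have dg : 0 < mxnorm B (orthoproj (v ord0) *m y).
  by rewrite lt_neqAle eq_sym d0 sqrtr_ge0.
rewrite ler_pXn2r ?nnegrE ?sqrtr_ge0 ?mulr_ge0 ?sqrtr_ge0// => le_.
by rewrite /Gbar (negbTE d0) lee_fin ler_pdivrMr.
Qed.

(** The invariant of the iteration. The last clause says that the square of [Gbar] is at most [g],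
    with the denominator cleared. *)
Definition iterate_bounds (a g : R) (y : 'cV[R]_n.+1) : Prop :=
  [/\ norm2 y = 1, a <= `|eigcoord ord0 y| &
   \sum_(i < n.+1 | (m <= i)%N) gap i * eigcoord i y ^+ 2 <=
     g * (gap ord0 * eigcoord ord0 y ^+ 2)].

Lemma norm2_gt0 (y : 'cV[R]_n.+1) : 0 < `|eigcoord ord0 y| -> 0 < norm2 y.
Proof.
move=> y0; rewrite lt_neqAle sqrtr_ge0 andbT eq_sym -sqrf_eq0 norm2_eigcoord.
rewrite psumr_eq0 => [|i _]; last exact: sqr_ge0.
apply/allPn; exists ord0; first by rewrite mem_index_enum.
by rewrite sqrf_eq0 -normr_eq0 gt_eqF.
Qed.

Lemma norm2_normalize (y : 'cV[R]_n.+1) : 0 < norm2 y -> norm2 (normalize y) = 1.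
Proof.
move=> y0; apply/eqP; rewrite -(@pexpr_eq1 _ _ 2)// ?sqrtr_ge0//.
rewrite norm2_eigcoord; under eq_bigr do rewrite eigcoordZ exprMn.
by rewrite -mulr_sumr -norm2_eigcoord -exprMn mulVf ?expr1n// gt_eqF.
Qed.

Lemma iterate_bounds_normalize a g (y : 'cV[R]_n.+1) : 0 < norm2 y ->
  a * norm2 y <= `|eigcoord ord0 y| ->
  \sum_(i < n.+1 | (m <= i)%N) gap i * eigcoord i y ^+ 2 <=
     g * (gap ord0 * eigcoord ord0 y ^+ 2) ->
  iterate_bounds a g (normalize y).
Proof.
move=> y0 ay gy; split; first exact: norm2_normalize.
  by rewrite eigcoordZ normrM normfV (gtr0_norm y0) [leRHS]mulrC ler_pdivlMr.
under eq_bigr do rewrite eigcoordZ exprMn mulrCA.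
rewrite eigcoordZ exprMn -mulr_sumr.
rewrite [leRHS](_ : _ =
  (norm2 y)^-1 ^+ 2 * (g * (gap ord0 * eigcoord ord0 y ^+ 2))); last by ring.
by rewrite ler_wpM2l ?sqr_ge0.
Qed.

(** The head is at least [(a - h) / gap ord0] and the norm at most [(1 + h) / gap ord0]. After
    normalization this leaves [(a - h) / (1 + h) >= a - 2 * h], because a coordinate of a unit
    vector gives [a <= 1]. *)
Lemma iterate_bounds_step (a g h : R) (x y : 'cV[R]_n.+1) :
  0 < h -> 0 < a -> h <= a / 2 -> 0 <= g -> iterate_bounds a g x ->
  mxnorm B (y - invmx B *m x) <= h / Num.sqrt (gap ord0) ->
  iterate_bounds (a - 2 * h) (g / 100 + 8 * (h / a) ^+ 2) (normalize y).
Proof.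
move=> h0 a0 ha g0 [x1 ax gx] ey.
have w0 := gap_head_gt0.
pose z i := eigcoord i x; pose e i := eigcoord i (y - invmx B *m x).
have yE i : eigcoord i y = z i / gap i + e i.
  by rewrite /z /e -eigcoord_inv_shifted_mx -eigcoordD subrKC.
have z1 : \sum_i z i ^+ 2 = 1 by rewrite -norm2_eigcoord x1 expr1n.
have eh : \sum_i gap i * e i ^+ 2 <= h ^+ 2 / gap ord0.
  rewrite -mxnorm_eigcoord -[in leRHS](sqr_sqrtr (ltW w0)) -expr_div_n.
  by rewrite ler_pXn2r ?nnegrE ?sqrtr_ge0 ?divr_ge0 ?sqrtr_ge0// ltW.
have hd : (`|z ord0| - h) / gap ord0 <= `|eigcoord ord0 y|.
  by rewrite yE; exact: perturbed_head_ge gap_head_le h0 eh.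
have nm : \sum_i eigcoord i y ^+ 2 <= ((1 + h) / gap ord0) ^+ 2.
  under eq_bigr do rewrite yE.
  exact: perturbed_norm_le gap_head_le h0 z1 eh.
have rt : \sum_(i < n.+1 | (m <= i)%N) gap i * eigcoord i y ^+ 2 <=
    (g / 100 + 8 * (h / a) ^+ 2) * (gap ord0 * eigcoord ord0 y ^+ 2).
  under eq_bigr do rewrite yE.
  rewrite yE.
  exact: perturbed_ratio_le gap_head_le gap_bottom_ge h0 eh _ _ a0 ha ax g0 gx.
have z01 : `|z ord0| <= 1.
  rewrite -(@ler_pXn2r _ 2)// ?nnegrE// expr1n real_normK ?num_real// -z1.
  by rewrite (bigD1 ord0)//= lerDl sumr_ge0// => i _; exact: sqr_ge0.
have az : a <= `|z ord0| by [].
have y0 : 0 < `|eigcoord ord0 y|.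
  by apply: lt_le_trans hd; rewrite divr_gt0//; lra.
have ny := norm2_gt0 y0.
have ny' : norm2 y <= (1 + h) / gap ord0.
  rewrite -(@ler_pXn2r _ 2)// ?nnegrE ?sqrtr_ge0// ?norm2_eigcoord//.
  exact: divr_ge0 (addr_ge0 ler01 (ltW h0)) (ltW w0).
apply: iterate_bounds_normalize => //.
have [a2|a2] := ltP 0 (a - 2 * h); last first.
  by rewrite (le_trans _ (ltW y0))// mulr_le0_ge0 ?sqrtr_ge0.
apply: le_trans (ler_wpM2l (ltW a2) ny') _; apply: le_trans hd.
by rewrite mulrA ler_wpM2r ?invr_ge0 ?(ltW w0)//; nra.
Qed.

Lemma iterate_bounds_weakenr a g g' y : g <= g' ->
  iterate_bounds a g y -> iterate_bounds a g' y.
Proof.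
move=> gg' [y1 ay gy]; split => //; apply: (le_trans gy); rewrite ler_wpM2r//.
by rewrite (mulr_ge0 (ltW gap_head_gt0) (sqr_ge0 _)).
Qed.

(** Positive semidefiniteness bounds every gap by the shift, at most [101 / 100 * lam ord0], whereas
    the head gap is [eps / 100 * lam ord0]; their quotient is the factor [101 / eps]. *)
Lemma iterate_bounds_normalize_start (y : 'cV[R]_n.+1) (a r : R) : 0 < a -> 0 < r ->
  psd Sigma -> eps < 1 -> a <= `|eigcoord ord0 y| -> norm2 y <= r ->
  iterate_bounds (a / r) (101 / eps * (r / a) ^+ 2) (normalize y).
Proof.
move=> a0 r0 pS e1 ay yr.
have y0 : 0 < `|eigcoord ord0 y| by exact: lt_le_trans ay.
have ny := norm2_gt0 y0.
apply: iterate_bounds_normalize => //.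
  by apply: le_trans ay; rewrite mulrAC ler_pdivrMr// ler_wpM2l// ltW.
have lam_ge0 i : 0 <= lam i.
  have := pS (v i); rewrite -mulmxA; case: eig => _ vv ->.
  by rewrite -scalemxAr mxE vv eqxx mulr1.
have s0 : 0 <= Defs.shift eps lam.
  by rewrite /Defs.shift mulr_ge0 ?addr_ge0 ?divr_ge0// ltW.
apply: (@le_trans _ _ (Defs.shift eps lam * r ^+ 2)).
  apply: (@le_trans _ _ (Defs.shift eps lam * norm2 y ^+ 2)); last first.
    by rewrite ler_wpM2l// ler_pXn2r// nnegrE ltW.
  rewrite norm2_eigcoord mulr_sumr [leRHS](bigID (fun i : 'I_n.+1 => m <= i)%N)/=.
  rewrite -[leLHS]addr0 lerD//.
    apply: ler_sum => i _; rewrite ler_wpM2r ?sqr_ge0// /gap lerBlDr lerDl//.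
  by rewrite sumr_ge0// => i _; rewrite mulr_ge0 ?sqr_ge0.
have -> : 101 / eps * (r / a) ^+ 2 * (gap ord0 * eigcoord ord0 y ^+ 2) =
   (101 / 100 * lam ord0 * r ^+ 2) * (`|eigcoord ord0 y| / a) ^+ 2.
  rewrite gap_head [in RHS]expr_div_n real_normK ?num_real//.
  by field; rewrite !gt_eqF.
have c1 : 1 <= (`|eigcoord ord0 y| / a) ^+ 2.
  by rewrite exprn_ege1// ler_pdivlMr// mul1r.
have c2 : Defs.shift eps lam * r ^+ 2 <= 101 / 100 * lam ord0 * r ^+ 2.
  by rewrite ler_wpM2r ?sqr_ge0// /Defs.shift ler_wpM2r ?(ltW lam0_gt0)//; lra.
apply: (le_trans c2); rewrite ler_peMr// !mulr_ge0 ?(ltW lam0_gt0)//; exact: ltW.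
Qed.

End eigenbasis.

(** * Measurability of matrix-valued maps, checked entry by entry *)

Section measurable_matrix_functions.
Context {dT : measure_display} {T : measurableType dT} {R : realType}.

Lemma measurable_mx_entry (m n : nat) (i : 'I_m) (j : 'I_n) :
  measurable_fun setT (fun A : 'M[R]_(m, n) => A i j).
Proof.
by move=> _ Y mY; apply: sub_sigma_algebra; exists (i, j) => //; exists Y.
Qed.

Lemma measurable_fun_mx (m n : nat) (f : T -> 'M[R]_(m, n)) :
  (forall i j, measurable_fun setT (fun t => f t i j)) -> measurable_fun setT f.
Proof.
move=> mf; apply: (@measurability _ _ _ _ _ _
  (\bigcup_(ij in [set: 'I_m * 'I_n]) preimage_set_system setT
     (fun A : 'M[R]_(m, n) => A ij.1 ij.2) measurable)) => //.
move=> _ [A [[i j] _ [Y mY <-]] <-].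
by rewrite setTI; exact: mf.
Qed.

Lemma measurable_entry (m n : nat) (f : T -> 'M[R]_(m, n)) i j :
  measurable_fun setT f -> measurable_fun setT (fun t => f t i j).
Proof. by move=> mf; exact: (measurableT_comp (@measurable_mx_entry m n i j)). Qed.

Lemma measurable_mulmx (m n p : nat) (f : T -> 'M[R]_(m, n)) (g : T -> 'M[R]_(n, p)) :
  measurable_fun setT f -> measurable_fun setT g ->
  measurable_fun setT (fun t => f t *m g t).
Proof.
move=> mf mg; apply: measurable_fun_mx => i j; under eq_fun do rewrite mxE.
by apply: measurable_sum => k; apply: measurable_funM; exact: measurable_entry.
Qed.

Lemma measurable_trmx (m n : nat) (f : T -> 'M[R]_(m, n)) :
  measurable_fun setT f -> measurable_fun setT (fun t => (f t)^T).
Proof.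
move=> mf; apply: measurable_fun_mx => i j; under eq_fun do rewrite mxE.
exact: measurable_entry.
Qed.

Lemma measurable_scalemx (m n : nat) (a : T -> R) (f : T -> 'M[R]_(m, n)) :
  measurable_fun setT a -> measurable_fun setT f ->
  measurable_fun setT (fun t => a t *: f t).
Proof.
move=> ma mf; apply: measurable_fun_mx => i j; under eq_fun do rewrite mxE.
by apply: measurable_funM => //; exact: measurable_entry.
Qed.

Lemma measurable_submx (m n : nat) (f g : T -> 'M[R]_(m, n)) :
  measurable_fun setT f -> measurable_fun setT g ->
  measurable_fun setT (fun t => f t - g t).
Proof.
move=> mf mg; apply: measurable_fun_mx => i j; under eq_fun do rewrite !mxE.
by apply: measurable_funB; exact: measurable_entry.
Qed.

Lemma measurable_sqrt (f : T -> R) : measurable_fun setT f ->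
  measurable_fun setT (fun t => Num.sqrt (f t)).
Proof.
move=> mf; apply: (measurableT_comp _ mf).
apply: continuous_measurable_fun.
exact: sqrt_continuous.
Qed.

Lemma measurable_mxnorm (n : nat) (B : 'M[R]_n) (f : T -> 'cV[R]_n) :
  measurable_fun setT f -> measurable_fun setT (fun t => mxnorm B (f t)).
Proof.
move=> mf; apply: measurable_sqrt; apply: measurable_entry.
apply: measurable_mulmx => //; apply: measurable_mulmx => //.
exact: measurable_trmx.
Qed.

Lemma measurable_normalize (n : nat) (f : T -> 'cV[R]_n) :
  measurable_fun setT f -> measurable_fun setT (fun t => normalize (f t)).
Proof.
move=> mf; apply: measurable_scalemx => //.
(* The inverse is discontinuous at 0, but on nonnegative reals it agrees with the measurable power
   of exponent -1, also at 0. *)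
under eq_fun do rewrite -powR_inv1 ?sqrtr_ge0//.
apply: (measurableT_comp (measurable_powR _)); apply: measurable_sqrt.
apply: measurable_entry; apply: measurable_mulmx => //; exact: measurable_trmx.
Qed.

End measurable_matrix_functions.

(** * Integration against a measure given by a density *)

Section density.
Import HBNNSimple.

(** The hypothesis is the case of indicators; linearity extends it to simple functions and monotone
    convergence to nonnegative measurable ones. *)
Lemma ge0_integral_density (dT : measure_display) (T : measurableType dT)
    (R : realType) (mu nu : {measure set T -> \bar R}) (p : T -> R)
    (f : T -> \bar R) :
  measurable_fun setT p -> (forall x, 0 <= p x) ->
  (forall A, measurable A -> nu A = \int[mu]_(x in A) (p x)%:E)%E ->
  measurable_fun setT f -> (forall x, 0 <= f x)%E ->
  (\int[nu]_x f x = \int[mu]_x (f x * (p x)%:E))%E.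
Proof.
move=> mp p0 nuE mf f0.
have mpE : measurable_fun setT (EFin \o p) by exact/measurable_EFinP.
pose f_ := nnsfun_approx measurableT mf.
transitivity (limn (fun n => \int[nu]_x (f_ n x)%:E))%E.
  rewrite -monotone_convergence//=.
  - apply: eq_integral => x _; apply/esym/cvg_lim => //=.
    exact: cvg_nnsfun_approx.
  - by move=> n; exact/measurable_EFinP.
  - by move=> n x _; rewrite lee_fin.
  - by move=> x _ a b ab; rewrite lee_fin; exact/lefP/nd_nnsfun_approx.
transitivity (limn (fun n => \int[mu]_x ((f_ n x)%:E * (p x)%:E)))%E; last first.
  rewrite -monotone_convergence//=.
  - apply: eq_integral => x _; apply/cvg_lim => //=.
    by apply: cvgeZr => //; exact: cvg_nnsfun_approx.
  - by move=> n; apply: emeasurable_funM => //; exact/measurable_EFinP.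
  - by move=> n x _; rewrite mule_ge0 ?lee_fin.
  - move=> x _ a b ab; rewrite lee_wpmul2r ?lee_fin//.
    exact/lefP/nd_nnsfun_approx.
apply: congr_lim; apply/funext => n /=.
under [LHS]eq_integral do rewrite fimfunE -fsumEFin//.
under [RHS]eq_integral.
  move=> x _; rewrite fimfunE -fsumEFin// muleC ge0_mule_fsumr; last first.
    by move=> r; rewrite EFinM nnfun_muleindic_ge0.
  over.
rewrite [LHS]ge0_integral_fsum//; last 2 first.
  - by move=> r; exact/measurable_EFinP/measurableT_comp.
  - by move=> r x _; rewrite EFinM nnfun_muleindic_ge0.
rewrite [RHS]ge0_integral_fsum//; last 2 first.
  - move=> r; apply: emeasurable_funM => //.
    by apply/measurable_EFinP; apply: measurable_funM.
  - by move=> r x _; apply: mule_ge0; rewrite ?EFinM ?nnfun_muleindic_ge0 ?lee_fin.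
apply: eq_fsbigr => r /[!inE] -[x _ rE].
have r0 : 0 <= r by rewrite -rE.
have mr : measurable (f_ n @^-1` [set r]) by [].
rewrite integralZl_indic_nnsfun// integral_indic// setIT nuE//.
under [RHS]eq_integral do rewrite EFinM muleCA.
rewrite ge0_integralZl//; last 2 first.
  by apply: emeasurable_funM => //; exact/measurable_EFinP.
  by move=> y _; rewrite mule_ge0 ?lee_fin.
congr (_ * _)%E; rewrite integral_mkcond; apply: eq_integral => y _.
by rewrite patchE indicE; case: (y \in _); rewrite ?mule1 ?mule0.
Qed.

End density.

(** * Independence of generated sigma-algebras, product laws and Markov's inequality *)

Section independence.
Context {dO : measure_display} {Omega : measurableType dO} {R : realType}.
Variable P : probability Omega R.
Local Open Scope ereal_scope.

Lemma setI_closed_sigma_of (dT : measure_display) (T : measurableType dT)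
  (X : Omega -> T) : setI_closed (sigma_of X).
Proof.
move=> _ _ [A mA <-] [B mB <-]; exists (A `&` B); first exact: measurableI.
by rewrite !setTI preimage_setI.
Qed.

Lemma sigma_of_setT (dT : measure_display) (T : measurableType dT)
  (X : Omega -> T) : sigma_of X setT.
Proof. by exists setT => //; rewrite preimage_setT setIT. Qed.

Lemma sigma_of_measurable (dT : measure_display) (T : measurableType dT)
  (X : Omega -> T) : measurable_fun setT X -> sigma_of X `<=` measurable.
Proof. by move=> mX _ [A mA <-]; exact: mX. Qed.

(** A pi-system argument: the finite measures sending [G] to [P (G]&[A)] and to [P G * P A] agree on
    the finite intersections [C] of events from the families in [J], hence on the sigma-algebra that
    these generate. *)
Lemma mutually_independent_generated (I : choiceType)
    (F : I -> set (set Omega)) (J : set I) (i : I) (G A : set Omega) :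
  mutually_independent P F ->
  (forall j, F j `<=` measurable) -> (forall j, F j setT) ->
  (forall j, setI_closed (F j)) -> ~ J i ->
  <<s \bigcup_(j in J) F j >> G -> F i A -> P (G `&` A) = P G * P A.
Proof.
move=> indF Fm FT FI Ji sG FA.
pose C := [set H | exists (K : {fset I}) (E : I -> set Omega),
  [/\ forall j, j \in K -> J j, forall j, F j (E j) &
      H = \bigcap_(j in [set` K]) E j]].
have mA : measurable A by exact: Fm FA.
have CT : C setT.
  exists fset0, (fun=> setT); split => //.
  by rewrite set_fset0 bigcap_set0.
have Cm : C `<=` measurable.
  move=> _ [K [E [_ FE ->]]]; apply: fin_bigcap_measurable => // j _.
  exact: Fm (FE j).
have CI : setI_closed C.
  move=> _ _ [K [E [KJ FE ->]]] [K' [E' [KJ' FE' ->]]].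
  (* Each intersection is padded with [setT] outside its own index set, so both run over the
     union. *)
  exists (K `|` K')%fset, (fun j => (if j \in K then E j else setT) `&`
     (if j \in K' then E' j else setT)); split.
  - by move=> j; rewrite inE => /orP[/KJ|/KJ'].
  - by move=> j; apply: FI; case: ifP.
  - apply/seteqP; split => w.
      move=> [Kw K'w] j /= _; split.
        by case: ifPn => // jK; exact: Kw.
      by case: ifPn => // jK; exact: K'w.
    move=> KKw; split => j /= jK.
      by have := KKw j; rewrite /= inE jK => /(_ isT)[].
    by have := KKw j; rewrite /= inE jK orbT => /(_ isT)[].
have {}sG : <<s C >> G.
  apply: sub_sigma_algebra2 sG => H [j Jj FH].
  exists [fset j]%fset, (fun k => if k == j then H else setT); split.
  - by move=> k; rewrite inE => /eqP ->.
  - by move=> k; case: eqP => [->|].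
  - by rewrite set_fset1 bigcap_set1 eqxx.
have PAE : P A = (fine (P A))%:E by rewrite fineK// fin_num_measure.
pose r : {nonneg R} := NngNum (fine_ge0 (measure_ge0 P A)).
have -> : P (G `&` A) = mrestr P mA G by [].
have -> : P G * P A = mscale r P G by rewrite /mscale /= muleC -PAE.
apply: (@g_sigma_algebra_measure_unique _ _ _ C Cm (fun=> setT)) => //.
- by rewrite bigcup_const//; exists 0%N.
- move=> _ [K [E [KJ FE ->]]].
  suff : P (\bigcap_(j in [set` K]) E j `&` A) =
    (fine (P A))%:E * P (\bigcap_(j in [set` K]) E j) by [].
  have iK : i \notin K by apply/negP => /KJ.
  (* Since [i] is outside [K], the event [A] can be inserted as a new factor of index [i]. *)
  pose E' j := if j == i then A else E j.
  have -> : \bigcap_(j in [set` K]) E j `&` A = \bigcap_(j in [set` (i |` K)%fset]) E' j.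
    apply/seteqP; split => w.
      move=> [Kw Aw] j /=; rewrite /E' !inE => /orP[/eqP ->|jK]; first by rewrite eqxx.
      by case: eqP => // _; exact: Kw.
    move=> KKw; split.
      move=> j /= jK; have := KKw j; rewrite /= !inE jK orbT => /(_ isT).
      by rewrite /E'; case: eqP => // ji; move: iK; rewrite -ji jK.
    by have := KKw i; rewrite /= !inE eqxx => /(_ isT); rewrite /E' eqxx.
  rewrite indF; last first.
    by move=> j _; rewrite /E'; case: eqP => [->|].
  rewrite indF; last by move=> j _; exact: FE.
  rewrite big_fsetU1//= EFinM {1}/E' eqxx; congr (_ * _%:E).
  rewrite [LHS]big_seq_cond [RHS]big_seq_cond; apply: eq_bigr => j.
  by rewrite andbT /E' => jK; case: eqP => // ji; move: iK; rewrite -ji jK.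
- move=> k; rewrite /= /mrestr setTI; apply: le_lt_trans (probability_le1 P mA) _.
  exact: ltry.
Qed.

Context {d1 d2 : measure_display} {T1 : measurableType d1} {T2 : measurableType d2}.

(** The product formula on rectangles identifies the joint law with the product of the law of [X]
    and [Q]; Tonelli then integrates out the second variable. *)
Lemma ge0_integral_independent_pair (X : {RV P >-> T1}) (Y : {RV P >-> T2})
    (Q : probability T2 R) (f : T1 * T2 -> \bar R) :
  (forall U W, measurable U -> measurable W ->
     P (X @^-1` U `&` Y @^-1` W) = P (X @^-1` U) * Q W) ->
  measurable_fun setT f -> (forall z, 0 <= f z) ->
  \int[P]_w f (X w, Y w) = \int[P]_w \int[Q]_y f (X w, y).
Proof.
move=> XY mf f0.
have mXY : measurable_fun setT (fun w => (X w, Y w)).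
  by apply: measurable_fun_pair.
transitivity (\int[pushforward P (fun w => (X w, Y w))]_z f z).
  by rewrite ge0_integral_pushforward.
rewrite (eq_measure_integral (distribution P X \x Q)); last first.
  move=> A mA _; apply/esym.
  pose h : {mfun Omega >-> (T1 * T2)%type} := HB.pack (fun w => (X w, Y w))
    (isMeasurableFun.Build _ _ _ _ _ mXY).
  apply: (@product_measure_unique _ _ _ _ _ _ _ (distribution P h)) => //.
rewrite fubini_tonelli1// ge0_integral_distribution//.
  exact: measurable_fun_fubini_tonelli_F.
by move=> x; apply: integral_ge0.
Qed.

Lemma markov_ge0 (f : Omega -> R) (a b : R) : measurable_fun setT f ->
  (forall w, 0 <= f w)%R -> (0 < a)%R -> \int[P]_w (f w)%:E <= b%:E ->
  P [set w | a <= f w]%R <= (b / a)%:E.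
Proof.
move=> mf f0 a0 fb.
have := @le_integral_comp_abse _ _ _ P setT measurableT (EFin \o f) a id
  (@measurable_id _ _ _) (fun _ => id) (fun _ _ _ _ => id).
have mfE : measurable_fun setT (EFin \o f) by exact/measurable_EFinP.
move=> /(_ mfE a0); rewrite setTI /=.
have -> : [set x | a%:E <= (`|f x|)%:E] = [set w | a <= f w]%R.
  by apply/seteqP; split => w /=; rewrite lee_fin ger0_norm.
under eq_integral do rewrite ger0_norm//.
move=> /le_trans/(_ fb); rewrite muleC -lee_pdivlMr// => /le_trans; apply.
Qed.

End independence.

Lemma measurable_set_ler (dT : measure_display) (T : measurableType dT)
    (R : realType) (f g : T -> R) :
  measurable_fun setT f -> measurable_fun setT g ->
  measurable [set t | f t <= g t].
Proof.
move=> mf mg; have := measurable_fun_ler mf mg measurableT (Y := [set true]).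
by rewrite setTI; apply.
Qed.

(** * Two computations with the standard normal density *)

Section gaussian.
Context {R : realType}.
Local Notation mu := (@lebesgue_measure R).

(** Comparison with the normal density of standard deviation 2: the quotient of the two densities at
    [y] is [2 * expR (- (3 / 8 * y ^+ 2))], where [3 / 8 = 1 / 2 - 1 / 8]. *)
Lemma normal_tail_le (s : R) : 0 <= s ->
  (normal_prob 0 1 [set y : R | (s <= `|y|)%R] <= (2 * expR (- (3 / 8 * s ^+ 2)))%:E)%E.
Proof.
move=> s0; set A := [set y | _].
have mA : measurable A.
  by apply: measurable_set_ler => //; exact: measurableT_comp.
pose c := 2 * expR (- (3 / 8 * s ^+ 2)).
have c0 : 0 <= c by rewrite mulr_ge0 ?expR_ge0.
have pk : normal_peak 1 = 2 * normal_peak 2 :> R.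
  rewrite /normal_peak expr1n mul1r -mulrnAr sqrtrM ?sqr_ge0// sqrtr_sqr ger0_norm//.
  by rewrite invfM mulrA divff// mul1r.
have le_pdf y : A y -> normal_pdf 0 1 y <= c * normal_pdf 0 2 y.
  rewrite /A /= => sy; rewrite !normal_pdfE ?oner_neq0 ?pnatr_eq0// pk.
  rewrite /c [leRHS](_ : _ = 2 * normal_peak 2 *
    (expR (- (3 / 8 * s ^+ 2)) * normal_fun 0 2 y)); last by ring.
  rewrite ler_wpM2l ?mulr_ge0 ?normal_peak_ge0//.
  rewrite /normal_fun -expRD ler_expR.
  have : s ^+ 2 <= y ^+ 2.
    by rewrite -[leRHS]real_normK ?num_real// ler_pXn2r ?nnegrE.
  by rewrite subr0; lra.
apply: (@le_trans _ _ (\int[mu]_(y in A) (c * normal_pdf 0 2 y)%:E)%E).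
  apply: ge0_le_integral => //=.
  - by move=> y _; rewrite lee_fin normal_pdf_ge0.
  - by apply/measurable_EFinP/measurable_funTS; exact: measurable_normal_pdf.
  - apply/measurable_EFinP/measurable_funTS; apply: measurable_funM => //.
    exact: measurable_normal_pdf.
under eq_integral do rewrite EFinM.
rewrite ge0_integralZl//=; last 2 first.
  - by apply/measurable_EFinP/measurable_funTS; exact: measurable_normal_pdf.
  - by move=> y _; rewrite lee_fin normal_pdf_ge0.
rewrite -[leRHS]mule1 lee_wpmul2l ?lee_fin//.
exact: (probability_le1 (normal_prob 0 2 : probability _ R) mA).
Qed.

(** Completing the square in [y] turns the integrand into a constant times the normal density of
    mean [m] and standard deviation [s], which integrates to 1. *)
Lemma integral_normal_expR_sqr (t z u : R) : 0 <= t ->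
  (\int[normal_prob 0 1]_y (expR (- (t * (z + u * y) ^+ 2)))%:E =
   ((Num.sqrt (1 + 2 * t * u ^+ 2))^-1 *
     expR (- (t / (1 + 2 * t * u ^+ 2) * z ^+ 2)))%:E)%E.
Proof.
move=> t0; set q := 1 + 2 * t * u ^+ 2.
have q0 : 0 < q by rewrite ltr_pwDl// mulr_ge0 ?sqr_ge0// mulr_ge0.
have sq0 : Num.sqrt q != 0 by rewrite gt_eqF// sqrtr_gt0.
rewrite (@ge0_integral_density _ _ _ mu _ (normal_pdf 0 1)); first last.
- by move=> y; rewrite lee_fin expR_ge0.
- apply/measurable_EFinP; apply: measurableT_comp => //; apply: measurableT_comp => //.
  apply: measurable_funM => //; apply: measurable_funX.
  by apply: measurable_funD => //; exact: measurable_funM.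
- by [].
- by move=> x; exact: normal_pdf_ge0.
- exact: measurable_normal_pdf.
pose m := - (2 * t * u * z / q); pose s := (Num.sqrt q)^-1.
have s0 : s != 0 by rewrite invr_neq0.
set c := (_^-1 * _)%R.
have c0 : 0 <= c by rewrite mulr_ge0 ?expR_ge0 ?invr_ge0 ?sqrtr_ge0.
transitivity (\int[mu]_y (c%:E * (normal_pdf m s y)%:E))%E; last first.
  rewrite ge0_integralZl//.
  - by rewrite integral_normal_pdf mule1.
  - by apply/measurable_EFinP; exact: measurable_normal_pdf.
  - by move=> y _; rewrite lee_fin normal_pdf_ge0.
apply: eq_integral => y _; rewrite -!EFinM; congr EFin.
rewrite !normal_pdfE ?oner_neq0//.
have -> : normal_peak s = Num.sqrt q * normal_peak 1.
  rewrite /normal_peak expr1n mul1r -mulrnAr sqrtrM ?sqr_ge0// sqrtr_sqr ger0_norm.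
    by rewrite invfM invrK.
  by rewrite invr_ge0 sqrtr_ge0.
rewrite /c /normal_fun [RHS](_ : _ = normal_peak 1 *
  (expR (- (t / q * z ^+ 2)) * expR (- (y - m) ^+ 2 / (s ^+ 2 *+ 2)))); last by field.
rewrite mulrCA -!expRD; congr (_ * expR _).
rewrite subr0 expr1n exprVn sqr_sqrtr ?ltW// /m /q; field.
by rewrite gt_eqF.
Qed.

End gaussian.

(** * Linear forms of a standard Gaussian vector *)

Section gaussian_vector.
Context {dO : measure_display} {Omega : measurableType dO} {R : realType}.
Variables (P : probability Omega R) (n : nat) (x : {RV P >-> 'cV[R]_n}).
Hypothesis gauss_x : standard_gaussian P x.

Let measurable_x i : measurable_fun setT (fun w => x w i 0).
Proof. by apply: measurable_entry. Qed.

Let partial_sum (u : 'I_n -> R) k w := \sum_(i < n | (i < k)%N) u i * x w i 0.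

Let partial_sumE u k : partial_sum u k =
  fun w => \sum_(i < n) if (i < k)%N then u i * x w i 0 else 0.
Proof. by apply/funext => w; rewrite /partial_sum big_mkcond. Qed.

Let measurable_partial_sum u k : measurable_fun setT (partial_sum u k).
Proof.
rewrite partial_sumE.
by apply: measurable_sum => i; case: (i < k)%N => //; exact: measurable_funM.
Qed.

Let measurable_partial_sum_past u k U : measurable U ->
  <<s \bigcup_(j in [set j : 'I_n | (j < k)%N]) sigma_of (fun w => x w j 0) >>
    (partial_sum u k @^-1` U).
Proof.
set G := \bigcup_(j in _) _ => mU.
have : measurable_fun (setT : set (g_sigma_algebraType G)) (partial_sum u k).
  rewrite partial_sumE.
  apply: measurable_sum => i; case: ltnP => // ik; apply: measurable_funM => //.
  move=> _ Y mY; apply: sub_sigma_algebra; exists i => //; exists Y => //.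
by move=> /(_ measurableT _ mU); rewrite setTI.
Qed.

(** Induction on the number of coordinates. Integrating out the last one, independent of the partial
    sum before it, leaves the same expectation with [t] replaced by [t / q], so the induction must
    quantify over [t]. *)
Lemma expectation_expR_sqr_gaussian (u : 'I_n -> R) (k : nat) (t : R) :
  (k <= n)%N -> 0 <= t ->
  (\int[P]_w (expR (- (t * (\sum_(i < n | (i < k)%N) u i * x w i 0) ^+ 2)))%:E =
   (Num.sqrt (1 + 2 * t * \sum_(i < n | (i < k)%N) u i ^+ 2))^-1%:E)%E.
Proof.
case: gauss_x => indx lawx.
elim: k t => [|k IH] t kn t0.
  under eq_integral do rewrite big_pred0_eq.
  rewrite big_pred0_eq.
  rewrite expr0n/= !mulr0 addr0 sqrtr1 invr1 oppr0 expR0.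
  rewrite integral_cst// mul1e; exact: probability_setT.
pose ik := Ordinal kn.
have split_sum (F : 'I_n -> R) :
    \sum_(i < n | (i < k.+1)%N) F i = \sum_(i < n | (i < k)%N) F i + F ik.
  rewrite (bigD1 ik)/= ?ltnS// addrC; congr (_ + _); apply: eq_bigl => i.
  by rewrite -val_eqE /= ltnS ltn_neqAle andbC.
under eq_integral do rewrite split_sum.
rewrite split_sum.
pose X : {RV P >-> R} := HB.pack (partial_sum u k)
  (isMeasurableFun.Build _ _ _ _ _ (measurable_partial_sum u k)).
have mY : measurable_fun setT ((fun w => x w ik 0) : Omega -> measurableTypeR R).
  exact: measurable_x.
pose Y : {RV P >-> measurableTypeR R} := HB.pack (fun w => x w ik 0)
  (isMeasurableFun.Build _ _ _ _ _ mY).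
pose f (zy : R * measurableTypeR R) := (expR (- (t * (zy.1 + u ik * zy.2) ^+ 2)))%:E.
have mf : measurable_fun setT f.
  apply/measurable_EFinP; apply: measurableT_comp => //; apply: measurableT_comp => //.
  apply: measurable_funM => //; apply: measurable_funX; apply: measurable_funD => //.
  by apply: measurable_funM => //; exact: measurable_snd.
have f0 z : (0 <= f z)%E by rewrite lee_fin expR_ge0.
have XY U W : measurable U -> measurable W ->
    (P (X @^-1` U `&` Y @^-1` W) = P (X @^-1` U) * normal_prob 0 1 W)%E.
  move=> mU mW; rewrite -(lawx ik)//.
  apply: (mutually_independent_generated indx (i := ik)
    (J := [set j : 'I_n | (j < k)%N])).
  - by move=> j; apply: sigma_of_measurable.
  - by move=> j; exact: sigma_of_setT.
  - by move=> j; exact: setI_closed_sigma_of.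
  - by rewrite /= ltnn.
  - exact: measurable_partial_sum_past.
  - by exists W => //; rewrite setTI.
rewrite -[LHS]/(\int[P]_w f (X w, Y w))%E.
rewrite (@ge0_integral_independent_pair _ _ _ P _ _ _ (measurableTypeR R) X Y
  (normal_prob 0 1) f XY mf f0).
rewrite /f /=; under eq_integral do rewrite integral_normal_expR_sqr// EFinM.
set q := 1 + 2 * t * u ik ^+ 2.
have q0 : 0 < q by rewrite ltr_pwDl// mulr_ge0 ?sqr_ge0// mulr_ge0.
rewrite ge0_integralZl//; last first.
  apply/measurable_EFinP; apply: measurableT_comp => //; apply: measurableT_comp => //.
  by apply: measurable_funM => //; exact: measurable_funX.
rewrite IH ?divr_ge0 ?(ltW q0)//; last exact: ltnW.
rewrite -EFinM -invfM -sqrtrM ?(ltW q0)//; congr (_^-1%:E); congr Num.sqrt.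
by rewrite /q; field; rewrite gt_eqF.
Qed.

(** Markov's inequality for [expR (- (t * Z ^+ 2))], with [Z] the linear form and
    [t = 1 / (2 * delta ^+ 2)]: this variable is at least [expR (- (1 / 2))] on the event, and its
    mean [1 / sqrt (1 + 1 / delta ^+ 2)] is at most [delta]. *)
Lemma gaussian_anticoncentration (u : 'I_n -> R) (delta : R) : 0 < delta ->
  \sum_i u i ^+ 2 = 1 ->
  (P [set w | `|\sum_i u i * x w i 0| <= delta]%R <= (expR (1 / 2) * delta)%:E)%E.
Proof.
move=> d0 u1.
pose t := (2 * delta ^+ 2)^-1.
have t0 : 0 <= t by rewrite invr_ge0 mulr_ge0 ?sqr_ge0.
have sumE (F : 'I_n -> R) : \sum_(i < n | (i < n)%N) F i = \sum_i F i.
  by apply: eq_bigl => i; rewrite ltn_ord.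
have := expectation_expR_sqr_gaussian u (leqnn n) t0.
under eq_integral do rewrite sumE.
rewrite sumE u1 mulr1 => E.
have mS : measurable_fun setT (fun w => \sum_i u i * x w i 0).
  by apply: measurable_sum => i; exact: measurable_funM.
have mf : measurable_fun setT (fun w => expR (- (t * (\sum_i u i * x w i 0) ^+ 2))).
  apply: measurableT_comp => //; apply: measurableT_comp => //.
  by apply: measurable_funM => //; exact: measurable_funX.
have Ele : (\int[P]_w (expR (- (t * (\sum_i u i * x w i 0) ^+ 2)))%:E <= delta%:E)%E.
  rewrite E lee_fin -[leRHS]invrK lef_pV2 ?posrE ?sqrtr_gt0 ?invr_gt0//; last first.
    by rewrite ltr_pwDl// mulr_ge0.
  rewrite -[leLHS]ger0_norm ?invr_ge0 ?(ltW d0)// -sqrtr_sqr ler_wsqrtr//.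
  rewrite /t [leRHS](_ : _ = 1 + delta^-1 ^+ 2) ?lerDr//.
  by field; rewrite gt_eqF.
have := markov_ge0 mf (fun w => expR_ge0 _) (expR_gt0 (- (1 / 2))) Ele.
rewrite [X in _ -> (_ <= X%:E)%E](_ : _ = delta / expR (- (1 / 2))); last first.
  by rewrite expRN invrK mulrC.
apply: le_trans; apply: le_measure.
- by rewrite inE; apply: measurable_set_ler => //; exact: measurableT_comp.
- by rewrite inE; exact: measurable_set_ler.
move=> w /= wd; rewrite ler_expR lerN2 /t invfM -mulrA.
rewrite div1r ler_piMr// mulrC ler_pdivrMr ?exprn_gt0// mul1r.
by rewrite -[leLHS]real_normK ?num_real// ler_pXn2r ?nnegrE// ltW.
Qed.

End gaussian_vector.

(** * The iterates as random variables, and their independence of the next seed *)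

Section random_iterates.
Context {R : realType} {dS : measure_display} {S : measurableType dS}.
Variables (n : nat) (solve : 'cV[R]_n -> S -> 'cV[R]_n).
Hypothesis msolve : measurable_fun setT (fun ys : 'cV[R]_n * S => solve ys.1 ys.2).

(** The domain is arbitrary and only the seeds before [t] are constrained, so that the sigma-algebra
    of the past can later be put on [Omega]. *)
Lemma measurable_power_iterates (dT : measure_display) (T : measurableType dT)
    (x0 : T -> 'cV[R]_n) (sd : nat -> T -> S) (t : nat) :
  measurable_fun setT x0 ->
  (forall k, (k < t)%N -> measurable_fun setT (sd k)) ->
  measurable_fun setT (fun w => power_iterates solve (x0 w) (sd ^~ w) t).
Proof.
move=> mx0; elim: t => [//|t IH] msd /=.
apply: measurable_normalize.
have mp : measurable_fun setT (fun w =>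
    (power_iterates solve (x0 w) (sd ^~ w) t, sd t w)).
  apply: measurable_fun_pair; last exact: msd.
  by apply: IH => k kt; apply: msd; exact: ltnW.
exact: (measurableT_comp msolve mp).
Qed.

Context {dO : measure_display} {Omega : measurableType dO}.
Variables (P : probability Omega R) (Q : probability S R).
Variables (x : {RV P >-> 'cV[R]_n}) (seed : nat -> {RV P >-> S}).
Hypothesis ind : independent_seeds Q x seed.

Let iter t w := power_iterates solve (normalize (x w)) (seed ^~ w) t.

Lemma measurable_random_iterates t : measurable_fun setT (iter t).
Proof. by apply: measurable_power_iterates => //; exact: measurable_normalize. Qed.

Lemma independent_random_iterate t U W : measurable U -> measurable W ->
  (P (iter t @^-1` U `&` seed t @^-1` W) = P (iter t @^-1` U) * Q W)%E.
Proof.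
move=> mU mW; case: ind => indF law; rewrite -(law t)//.
apply: (mutually_independent_generated indF (i := Some t)
  (J := [set o | if o is Some k then (k < t)%N else true])).
- by case=> [k|]; exact: sigma_of_measurable.
- by case=> [k|]; exact: sigma_of_setT.
- by case=> [k|]; exact: setI_closed_sigma_of.
- by rewrite /= ltnn.
- set G := \bigcup_(j in _) _.
  (* The iterate is measurable already for the sigma-algebra generated by [x] and the seeds before
     [t]. *)
  have : measurable_fun (setT : set (g_sigma_algebraType G)) (iter t).
    apply: measurable_power_iterates.
      apply: measurable_normalize => _ Y mY; apply: sub_sigma_algebra.
      by exists None => //; exists Y.
    move=> k kt _ Y mY; apply: sub_sigma_algebra.
    by exists (Some k) => //; exists Y.
  by move=> /(_ measurableT _ mU); rewrite setTI.
- by exists W => //; rewrite setTI.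
Qed.

(** A bound valid for every fixed input survives averaging over a random input independent of the
    seed. *)
Lemma expectation_solve_error (g : 'cV[R]_n * S -> R) (b : R) t :
  measurable_fun setT g -> (forall z, 0 <= g z) -> 0 <= b ->
  (forall y, (\int[Q]_s (g (y, s))%:E <= b%:E)%E) ->
  (\int[P]_w (g (iter t w, seed t w))%:E <= b%:E)%E.
Proof.
move=> mg g0 b0 gb.
pose X : {RV P >-> 'cV[R]_n} := HB.pack (iter t)
  (isMeasurableFun.Build _ _ _ _ _ (measurable_random_iterates t)).
have mgE : measurable_fun setT (EFin \o g) by exact/measurable_EFinP.
have gE0 z : (0 <= (EFin \o g) z)%E by rewrite lee_fin.
rewrite -[leLHS]/(\int[P]_w (EFin \o g) (X w, seed t w))%E.
rewrite (@ge0_integral_independent_pair _ _ _ P _ _ _ _ X (seed t) Q _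
  (@independent_random_iterate t) mgE gE0).
apply: (@le_trans _ _ (\int[P]_w b%:E)%E); last first.
  by rewrite integral_cst// [X in (_ * X)%E]probability_setT mule1.
apply: ge0_le_integral => //=.
- by move=> w _; apply: integral_ge0 => s _; rewrite lee_fin.
- exact: (measurableT_comp (measurable_fun_fubini_tonelli_F (m2 := Q) _ mgE gE0)
    (measurable_random_iterates t)).
Qed.

End random_iterates.

(** The value [+oo] at a zero denominator makes the event equivalent to [den > 0] and
    [num <= r * den], which involves no division. *)
Lemma measurable_Gbar_le (R : realType) (n : nat) (eps : R) (lam : 'I_n.+1 -> R)
    (v : 'I_n.+1 -> 'cV[R]_n.+1) (B : 'M[R]_n.+1) (r : R)
    (dT : measure_display) (T : measurableType dT) (f : T -> 'cV[R]_n.+1) :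
  measurable_fun setT f ->
  measurable [set t | (Gbar eps lam v B (f t) <= r%:E)%E].
Proof.
move=> mf.
pose num t := mxnorm B (orthoproj (bottom_mx eps lam v) *m f t).
pose den t := mxnorm B (orthoproj (v ord0) *m f t).
have mnum : measurable_fun setT num.
  by apply: measurable_mxnorm; exact: measurable_mulmx.
have mden : measurable_fun setT den.
  by apply: measurable_mxnorm; exact: measurable_mulmx.
rewrite [X in measurable X](_ : _ =
    ~` [set t | den t <= 0] `&` [set t | num t <= r * den t]).
  apply: measurableI; first by apply: measurableC; exact: measurable_set_ler.
  by apply: measurable_set_ler => //; exact: measurable_funM.
have den0 t : 0 <= den t by exact: sqrtr_ge0.
apply/seteqP; split => t /=; rewrite /Gbar -/(num t) -/(den t).
  case: eqP => [|/eqP d0]; first by rewrite leye_eq.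
  have dg : 0 < den t by rewrite lt_neqAle eq_sym d0 den0.
  by rewrite lee_fin ler_pdivrMr// => ?; split => //; apply/negP; rewrite -ltNge.
case=> /negP; rewrite -ltNge => dg nd.
by rewrite gt_eqF// lee_fin ler_pdivrMr.
Qed.

(** * Accumulation of the errors over all steps *)

Section deterministic_iterates.
Variables (R : realType) (n : nat).
Variables (Sigma : 'M[R]_n.+1) (lam : 'I_n.+1 -> R) (v : 'I_n.+1 -> 'cV[R]_n.+1).
Variable eps : R.
Hypotheses (eps_gt0 : 0 < eps) (lam0_gt0 : 0 < lam ord0).
Hypotheses (Sigma_sym : Sigma^T = Sigma) (eig : eigensystem Sigma lam v).
Let B := shifted_mx eps lam Sigma.

(** The head loses [2 * h] per step, so [4 * (T%:R * h) <= a] keeps it above [a / 2] and each step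
    adds at most [8 * (2 * h / a) ^+ 2]. The recursion closes with the constant 9 because
    [9 / 100 + 8 <= 9]. *)
Lemma power_iterates_bounds (S : Type) (solve : 'cV[R]_n.+1 -> S -> 'cV[R]_n.+1)
    (x0 : 'cV[R]_n.+1) (seed : nat -> S) (T : nat) (a g h : R) :
  let x := power_iterates solve x0 seed in
  0 < a -> 0 <= g -> 0 < h -> 4 * (T%:R * h) <= a ->
  iterate_bounds lam v eps a g x0 ->
  (forall t, (t < T)%N ->
    mxnorm B (solve (x t) (seed t) - invmx B *m x t) <=
    h / Num.sqrt (gap lam eps ord0)) ->
  forall t, (t <= T)%N ->
  iterate_bounds lam v eps (a - 2 * (t%:R * h))
    (g / 100 ^+ t + 9 * (2 * h / a) ^+ 2) (x t).
Proof.
move=> x a0 g0 h0 Th x0P err; elim=> [|t IH] tT.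
  rewrite mul0r mulr0 subr0 expr0 divr1.
  apply: (iterate_bounds_weakenr eps_gt0 lam0_gt0 _ x0P).
  by rewrite lerDl mulr_ge0 ?sqr_ge0.
have {}IH := IH (ltnW tT).
have tT' : t%:R + 1 <= T%:R :> R by rewrite natr1 ler_nat.
have th : (t%:R + 1) * h <= T%:R * h by rewrite ler_wpM2r// ltW.
set at_ := a - 2 * (t%:R * h) in IH.
have t0 : 0 <= t%:R * h by rewrite mulr_ge0// ltW.
have at2 : a / 2 <= at_ by rewrite /at_; lra.
have := iterate_bounds_step eps_gt0 lam0_gt0 Sigma_sym eig h0 _ _ _ IH (err t tT).
have -> : at_ - 2 * h = a - 2 * (t.+1%:R * h) by rewrite /at_ -natr1; ring.
move=> H; apply: (iterate_bounds_weakenr eps_gt0 lam0_gt0 _ (H _ _ _)).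
- have hat : (h / at_) ^+ 2 <= (2 * h / a) ^+ 2.
    have at0 : 0 < at_ by lra.
    rewrite ler_pXn2r ?nnegrE ?divr_ge0 ?(ltW at0) ?(ltW h0) ?(ltW a0)//; last first.
      by rewrite mulr_ge0// ltW.
    rewrite ler_pdivrMr// mulrAC ler_pdivlMr//.
    by nra.
  have -> : (g / 100 ^+ t + 9 * (2 * h / a) ^+ 2) / 100 =
     g / 100 ^+ t.+1 + 9 / 100 * (2 * h / a) ^+ 2.
    by rewrite (exprS 100 t) invfM; move: (100 ^+ t)^-1 (2 * h / a) => X Y; field.
  have := sqr_ge0 (2 * h / a); lra.
- lra.
- lra.
- by rewrite addr_ge0 ?divr_ge0 ?exprn_ge0// mulr_ge0 ?sqr_ge0.
Qed.

End deterministic_iterates.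

(** * Numerical estimates for the number of steps *)

Section parameters.
Variable R : realType.

(* The 64th root [q] of the dimension turns every logarithmic factor into a
   small power of [q]. *)
Lemma ln_add1_le_root (d : R) : 1 <= d ->
  exists q : R, [/\ 0 < q, q ^+ 64 = d & ln d + 1 <= 64 * q].
Proof.
move=> d1; have d0 : 0 < d by exact: lt_le_trans d1.
exists (expR (ln d / 64)); split; first exact: expR_gt0.
  by rewrite -expRM_natl mulrC divfK ?pnatr_eq0// lnK.
have : 0 <= ln d / 64 by rewrite divr_ge0 ?ln_ge0.
by have := @expR_ge1Dx R (ln d / 64); lra.
Qed.

Lemma expR1_le4 : expR 1 <= 4 :> R.
Proof.
have h2 : expR (1 / 2) <= 2 :> R.
  rewrite -[leRHS]invrK -[leLHS]invrK -expRN lef_pV2 ?posrE ?expR_gt0 ?invr_gt0//.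
  by have := @expR_ge1Dx R (- (1 / 2)); lra.
have -> : 1 = 1 / 2 + 1 / 2 :> R by lra.
rewrite expRD; have := @expR_ge0 R (1 / 2); nra.
Qed.

(** Each of the two terms of the final ratio gets half of [c ^+ 2 * eps]. The rate 24 makes
    [100 ^+ T] at least [(d / eps) ^+ 24 / 4], which beats the initial ratio, of size at most
    [101 * d ^+ 22 / eps]. *)
Lemma iteration_parameters (c : R) : 0 < c -> exists2 D : R, 1 <= D &
  forall (d eps : R) (T : nat), D <= d -> 0 < eps -> eps < 1 ->
  T%:R <= 24 * ln (d / eps) -> 24 * ln (d / eps) < T.+1%:R ->
  let r := Num.sqrt (30 * d * ln d) in
  let a := (d ^+ 10)^-1 / r in
  let h := T%:R * eps ^+ 3 / (3000 * d ^+ 11) in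
  [/\ (0 < T)%N, 0 < ln d, 4 * (T%:R * h) <= a &
   101 / eps * (r / (d ^+ 10)^-1) ^+ 2 / 100 ^+ T + 9 * (2 * h / a) ^+ 2 <=
     c ^+ 2 * eps].
Proof.
(* This gives [40 <= q] and [30 <= c * q], enough to absorb the numerical constants and [c] into
   powers of [q]. *)
move=> c0; pose q0 := 40 + 30 / c.
have c_ge0 : 0 <= c by exact: ltW.
have q0_40 : 40 <= q0 by rewrite lerDl (divr_ge0 (ler0n _ 30) c_ge0).
have q0_1 : 1 <= q0 by lra.
exists (q0 ^+ 64); first exact: exprn_ege1.
move=> d eps T Dd e0 e1 Tle Tgt.
have d1 : 1 <= d by apply: le_trans Dd; exact: exprn_ege1.
have d0 : 0 < d by exact: lt_le_trans d1.
have [q [qgt0 qd lnq]] := ln_add1_le_root d1.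
have q_ge0 : 0 <= q by exact: ltW.
have e_ge0 : 0 <= eps by exact: ltW.
have d_ge0 : 0 <= d by exact: ltW.
have q0q : q0 <= q.
  rewrite -(@ler_pXn2r _ 64) ?nnegrE ?qd//; exact: le_trans ler01 q0_1.
have q40 : 40 <= q by exact: le_trans q0q.
have q1 : 1 <= q by lra.
have qX m k : (m <= k)%N -> q ^+ m <= q ^+ k by exact: ler_weXn2l.
have qc : 30 <= c * q.
  have : 30 / c <= q by apply: le_trans q0q; rewrite lerDr.
  by rewrite ler_pdivrMr// mulrC.
have q_d : q <= d by rewrite -qd; exact: (qX 1%N 64%N).
have q2 : 1600 <= q ^+ 2 by rewrite expr2; nra.
have lnd1 : 1 <= ln d.
  by rewrite -ler_expR lnK// (le_trans expR1_le4)//; lra.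
have lneE : ln (d / eps) = ln d + ln eps^-1 by rewrite lnM ?posrE ?invr_gt0.
have lne0 : 0 <= ln eps^-1 by rewrite ln_ge0// invf_ge1// ltW.
have lne1 : ln eps^-1 <= eps^-1 - 1.
  have := @expR_ge1Dx R (ln eps^-1); rewrite lnK ?posrE ?invr_gt0//; lra.
have T0 : (0 < T)%N.
  by rewrite lt0n; apply/eqP => T0; move: Tgt; rewrite T0 lneE; lra.
(* A factor [eps] removes the dependence on [ln eps^-1], because [eps * ln eps^-1 <= 1]; what
   remains is [24 * (ln d + 1) <= 24 * 64 * q]. *)
have eT : eps * T%:R <= q ^+ 3.
  have h1 : eps * ln eps^-1 <= 1 - eps.
    have := ler_wpM2l e_ge0 lne1; rewrite mulrBr divff ?gt_eqF//; lra.
  have h2 : eps * ln d <= ln d by rewrite ler_piMl ?(le_trans ler01 lnd1)// ltW.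
  have h3 : eps * T%:R <= 24 * (eps * ln d + eps * ln eps^-1).
    by have := ler_wpM2l e_ge0 Tle; rewrite lneE; lra.
  apply: (@le_trans _ _ (1600 * q)); first by lra.
  by rewrite exprSr ler_wpM2r.
set r := Num.sqrt _; cbv zeta.
have r_arg : 0 < 30 * d * ln d.
  exact: mulr_gt0 (mulr_gt0 (ltr0Sn _ 29) d0) (lt_le_trans ltr01 lnd1).
have r2 : r ^+ 2 = 30 * d * ln d by exact: sqr_sqrtr (ltW r_arg).
have r0 : 0 < r by rewrite sqrtr_gt0.
have r_ge0 : 0 <= r by exact: ltW.
have r_le : r <= q ^+ 34.
  rewrite -(@ler_pXn2r _ 2) ?nnegrE ?exprn_ge0// r2 -exprM.
  have -> : q ^+ (34 * 2) = q ^+ 4 * d by rewrite -qd -exprD.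
  rewrite mulrAC ler_wpM2r//.
  apply: (@le_trans _ _ (1600 * (40 * q))); first by lra.
  have -> : q ^+ 4 = q ^+ 2 * (q * q) by ring.
  exact: ler_pM (ler0n _ _) (mulr_ge0 (ler0n _ 40) q_ge0) q2 (ler_wpM2r q_ge0 q40).
have eT0 : 0 <= eps * T%:R by exact: mulr_ge0.
have eTr0 : 0 <= eps * T%:R * r by exact: mulr_ge0.
have eTr : eps * T%:R * r * q <= d.
  apply: (@le_trans _ _ (q ^+ 3 * q ^+ 34 * q)).
    by rewrite ler_wpM2r// ler_pM.
  by rewrite -exprD -exprSr -qd; exact: qX.
have eTr2 : 4 * ((eps * T%:R) ^+ 2 * r) <= d.
  apply: (@le_trans _ _ (q * ((q ^+ 3) ^+ 2 * q ^+ 34))).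
    apply: ler_pM; [exact: ler0n|exact: mulr_ge0 (sqr_ge0 _) r_ge0|lra|].
    apply: ler_pM => //; first exact: sqr_ge0.
    by rewrite ler_pXn2r ?nnegrE ?exprn_ge0.
  by rewrite -exprM -exprD -exprS -qd; exact: qX.
have dn0 : d != 0 by rewrite gt_eqF.
have rn0 : r != 0 by rewrite gt_eqF.
have en0 : eps != 0 by rewrite gt_eqF.
have d10 : 0 < d ^+ 10 by exact: exprn_gt0.
have : 1 <= 3000 :> R by rewrite ler1n.
move: (3000 : R) => K K1; have K0 : 0 < K by lra.
have Kd : d <= K * d by rewrite ler_peMl.
have Kd0 : 0 < K * d by exact: mulr_gt0.
have Kn0 : K != 0 by rewrite gt_eqF.
split => //; first by lra.
  have -> : 4 * (T%:R * (T%:R * eps ^+ 3 / (K * d ^+ 11))) =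
    (d ^+ 10)^-1 * ((4 * ((eps * T%:R) ^+ 2 * r) * eps) / (K * d)) / r.
    by field; rewrite dn0 rn0 Kn0.
  rewrite ler_wpM2r ?invr_ge0// ler_piMr ?invr_ge0 ?(ltW d10)//.
  rewrite ler_pdivrMr// mul1r (le_trans _ Kd)// (le_trans _ eTr2)//.
  rewrite ler_piMr ?(ltW e1)//.
  exact: mulr_ge0 (ler0n _ 4) (mulr_ge0 (sqr_ge0 _) r_ge0).
have -> : 2 * (T%:R * eps ^+ 3 / (K * d ^+ 11)) / ((d ^+ 10)^-1 / r) =
    2 * eps ^+ 2 * (eps * T%:R * r) / (K * d) by field; rewrite dn0 rn0 Kn0.
(* The relative error [2 * h / a]; it is at most [2 * eps / q], hence small against [c * eps]. *)
set eta := 2 * eps ^+ 2 * _ / _.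
have e2 : 0 <= 2 * eps ^+ 2 by exact: mulr_ge0 (ler0n _ 2) (sqr_ge0 _).
have e2e : eps ^+ 2 <= eps by rewrite expr2 ler_piMr// ltW.
have eta_q : eta * q <= 2 * eps.
  have -> : eta * q = 2 * eps ^+ 2 * (eps * T%:R * r * q) / (K * d).
    by rewrite /eta; ring.
  rewrite ler_pdivrMr//.
  apply: ler_pM; [by []|exact: mulr_ge0|by lra|exact: le_trans Kd].
have eta0 : 0 <= eta by rewrite /eta divr_ge0 ?(ltW Kd0)//; exact: mulr_ge0.
have eta2 : 9 * eta ^+ 2 <= c ^+ 2 * eps / 2.
  have h1 : eta * 30 <= eta * (c * q) by exact: ler_wpM2l.
  have h2 : c * (eta * q) <= c * (2 * eps) by exact: ler_wpM2l.
  have h3 : eta <= c * eps / 15 by lra.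
  have h4 : eta ^+ 2 <= (c * eps / 15) ^+ 2.
    rewrite ler_pXn2r ?nnegrE//; exact: le_trans eta0 h3.
  have h5 : c ^+ 2 * eps ^+ 2 <= c ^+ 2 * eps.
    by rewrite ler_wpM2l ?sqr_ge0.
  have h6 : 0 <= c ^+ 2 * eps by exact: mulr_ge0 (sqr_ge0 _) e_ge0.
  have h7 : (c * eps / 15) ^+ 2 = c ^+ 2 * eps ^+ 2 / 225 by field.
  by lra.
have h100 : 0 < 100 ^+ T :> R by exact: exprn_gt0 (ltr0Sn _ 99).
(* [T] is a rounded-down value: the extra step in [T.+1] costs the factor [expR 1 <= 4]. *)
have pow100 : (d / eps) ^+ 24 <= 4 * 100 ^+ T.
  have -> : (d / eps) ^+ 24 = expR (24 * ln (d / eps)).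
    by rewrite expRM_natl lnK// posrE divr_gt0.
  apply: (@le_trans _ _ (expR T.+1%:R)); first by rewrite ler_expR ltW.
  rewrite -natr1 expRD mulrC ler_pM ?expR_ge0 ?expR1_le4//.
  rewrite -[T%:R]mulr1 expRM_natl ler_pXn2r ?nnegrE ?expR_ge0 ?ler0n//.
    by apply: le_trans expR1_le4 _; rewrite ler_nat.
have G0 : 101 / eps * (r / (d ^+ 10)^-1) ^+ 2 / 100 ^+ T <=
    404 * eps ^+ 23 / d ^+ 2.
  rewrite ler_pdivrMr//.
  have -> : 404 * eps ^+ 23 / d ^+ 2 * 100 ^+ T =
     101 * eps ^+ 23 / d ^+ 2 * (4 * 100 ^+ T).
    by move: (100 ^+ T) => y; ring.
  have k0 : 0 <= 101 * eps ^+ 23 / d ^+ 2.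
    exact: divr_ge0 (mulr_ge0 (ler0n _ 101) (exprn_ge0 _ e_ge0)) (sqr_ge0 _).
  apply: le_trans (ler_wpM2l k0 pow100).
  have -> : 101 * eps ^+ 23 / d ^+ 2 * (d / eps) ^+ 24 =
     101 / eps * (d ^+ 10) ^+ 2 * d ^+ 2 by field; rewrite en0 dn0.
  rewrite invrK exprMn [r ^+ 2 * _]mulrC mulrA ler_wpM2l//.
    exact: mulr_ge0 (divr_ge0 (ler0n _ 101) e_ge0) (sqr_ge0 _).
  rewrite ler_pXn2r ?nnegrE// (le_trans r_le)// -qd; exact: qX.
have G1 : 404 * eps ^+ 23 / d ^+ 2 <= c ^+ 2 * eps / 2.
  rewrite ler_pdivrMr ?exprn_gt0//.
  have e23 : eps ^+ 23 <= eps.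
    by rewrite exprS ler_piMr ?exprn_ile1// ltW.
  have cd : 30 <= c * d by apply: (le_trans qc); exact: ler_wpM2l.
  have cd2 : 900 <= (c * d) ^+ 2.
    by have := ler_pM (ler0n _ 30) (ler0n _ 30) cd cd; rewrite -natrM -expr2.
  have -> : c ^+ 2 * eps / 2 * d ^+ 2 = eps / 2 * (c * d) ^+ 2 by field.
  have : eps / 2 * 900 <= eps / 2 * (c * d) ^+ 2.
    by rewrite ler_wpM2l// (divr_ge0 e_ge0 (ler0n _ 2)).
  by lra.
by apply: (le_trans (lerD (le_trans G0 G1) eta2)); rewrite -splitr.
Qed.

End parameters.

Lemma union_bound (dT : measure_display) (T : measurableType dT) (R : realType)
    (P : probability T R) (N : nat) (A : nat -> set T) (b : R) :
  (forall i, (i < N)%N -> measurable (A i)) ->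
  (forall i, (i < N)%N -> (P (A i) <= b%:E)%E) ->
  (P (\big[setU/set0]_(i < N) A i) <= (N%:R * b)%:E)%E.
Proof.
move=> mA Ab; apply: (le_trans (Boole_inequality P mA)).
apply: (@le_trans _ _ (\sum_(i < N) b%:E)%E); first by apply: lee_sum => i _; exact: Ab.
by rewrite sumEFin sumr_const card_ord mulr_natl.
Qed.

Lemma norm2_le (R : realType) (n : nat) (y : 'cV[R]_n) (s : R) : 0 <= s ->
  (forall i, `|y i 0| <= s) -> norm2 y <= Num.sqrt (n%:R * s ^+ 2).
Proof.
move=> s0 ys; rewrite /norm2 ler_wsqrtr// mxE.
apply: (@le_trans _ _ (\sum_(i < n) s ^+ 2)).
  apply: ler_sum => i _; rewrite !mxE -expr2 -real_normK ?num_real//.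
  by rewrite ler_pXn2r ?nnegrE.
by rewrite sumr_const card_ord mulr_natl.
Qed.

(** * The three bad events and the probability of success *)

Section success.
Context {R : realType} {n : nat}.
Variables (Sigma : 'M[R]_n.+1) (lam : 'I_n.+1 -> R) (v : 'I_n.+1 -> 'cV[R]_n.+1).
Variables (eps : R) (T : nat).
Hypotheses (eps_gt0 : 0 < eps) (eps_lt1 : eps < 1) (lam0_gt0 : 0 < lam ord0).
Hypotheses (Sigma_sym : Sigma^T = Sigma) (Sigma_psd : psd Sigma).
Hypothesis eig : eigensystem Sigma lam v.
Hypothesis T_gt0 : (0 < T)%N.
Let d : R := n.+1%:R.
Let B := shifted_mx eps lam Sigma.
Let r := Num.sqrt (30 * d * ln d).
Let a := (d ^+ 10)^-1 / r.
Let h := T%:R * eps ^+ 3 / (3000 * d ^+ 11).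
Let err := eps ^+ 3 / (3000 * d ^+ 21) * Num.sqrt (eig_inv eps lam ord_max).
Let thr := T%:R * d ^+ 10 * err.
Hypotheses (lnd : 0 < ln d) (Tha : 4 * (T%:R * h) <= a).

Let d_gt0 : 0 < d. Proof. by rewrite ltr0n. Qed.

Let gap_max_gt0 : 0 < gap lam eps ord_max.
Proof. exact: gap_gt0 eps_gt0 lam0_gt0 eig _. Qed.

Lemma solve_error_gt0 : 0 < err.
Proof.
apply: mulr_gt0; last by rewrite sqrtr_gt0 invr_gt0; exact: gap_max_gt0.
exact: divr_gt0 (exprn_gt0 _ eps_gt0) (mulr_gt0 (ltr0Sn _ _) (exprn_gt0 _ d_gt0)).
Qed.

Lemma error_threshold_gt0 : 0 < thr.
Proof.
by rewrite (mulr_gt0 (mulr_gt0 _ (exprn_gt0 _ d_gt0)) solve_error_gt0)// ltr0n.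
Qed.

Let h_gt0 : 0 < h.
Proof.
apply: divr_gt0; first by rewrite (mulr_gt0 _ (exprn_gt0 _ eps_gt0))// ltr0n.
exact: mulr_gt0 (ltr0Sn _ _) (exprn_gt0 _ d_gt0).
Qed.

(** The solver's accuracy is scaled by the smallest eigenvalue of the inverse of [B], that is, by
    the largest gap, and the head gap is the smallest. *)
Lemma error_threshold_le : thr <= h / Num.sqrt (gap lam eps ord0).
Proof.
have -> : thr = h * Num.sqrt (eig_inv eps lam ord_max).
  by rewrite /thr /err /h; field; rewrite gt_eqF.
rewrite (ler_wpM2l (ltW h_gt0))//.
rewrite -sqrtrV ?(ltW (gap_head_gt0 eps_gt0 lam0_gt0))// ler_wsqrtr//.
rewrite lef_pV2 ?posrE ?gap_max_gt0 ?(gap_head_gt0 eps_gt0 lam0_gt0)//.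
exact: gap_head_le eig _.
Qed.

(** The deterministic core: no randomness is left once the head of [x], its entries and all solver
    errors are controlled. The entry bound gives [norm2 x <= r]. *)
Lemma Gbar_power_iterates_le (S : Type)
    (solve : 'cV[R]_n.+1 -> S -> 'cV[R]_n.+1) (x : 'cV[R]_n.+1) (seed : nat -> S)
    (c : R) :
  let y := power_iterates solve (normalize x) seed in
  0 < c ->
  101 / eps * (r / (d ^+ 10)^-1) ^+ 2 / 100 ^+ T + 9 * (2 * h / a) ^+ 2 <=
     c ^+ 2 * eps ->
  (d ^+ 10)^-1 <= `|eigcoord v ord0 x| ->
  (forall i, `|x i 0| <= Num.sqrt (30 * ln d)) ->
  (forall t, (t < T)%N ->
     mxnorm B (solve (y t) (seed t) - invmx B *m y t) <= thr) ->
  (Gbar eps lam v B (y T) <= (c * Num.sqrt eps)%:E)%E.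
Proof.
move=> y c0 G x0 xi et.
have r0 : 0 < r by rewrite sqrtr_gt0 (mulr_gt0 (mulr_gt0 (ltr0Sn _ 29) d_gt0) lnd).
have d10 : 0 < (d ^+ 10)^-1 by rewrite invr_gt0 exprn_gt0.
have a0 : 0 < a by rewrite divr_gt0.
have h0 := h_gt0.
have xr : norm2 x <= r.
  have := norm2_le (sqrtr_ge0 _) xi.
  rewrite (sqr_sqrtr (mulr_ge0 (ler0n _ 30) (ltW lnd))).
  by rewrite /r [30 * d]mulrC -mulrA.
have start := iterate_bounds_normalize_start eps_gt0 lam0_gt0 eig d10 r0
  Sigma_psd eps_lt1 x0 xr.
have := power_iterates_bounds eps_gt0 lam0_gt0 Sigma_sym eig a0 _ h0 Tha start
  (fun t tT => le_trans (et t tT) error_threshold_le).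
move=> H; have [] := H _ T (leqnn _).
  by rewrite mulr_ge0 ?divr_ge0 ?sqr_ge0 ?(ltW eps_gt0).
move=> _ yT gT.
apply: (Gbar_le eps_gt0 lam0_gt0 eig).
- by rewrite mulr_ge0 ?sqrtr_ge0 ?(ltW c0).
- rewrite -normr_gt0 (lt_le_trans _ yT)// -/a.
  by move: Tha a0; move: (T%:R * h) a => u b; lra.
apply: (le_trans gT); rewrite ler_wpM2r//.
  by rewrite (mulr_ge0 (ltW (gap_head_gt0 eps_gt0 lam0_gt0)) (sqr_ge0 _)).
by rewrite [leRHS]exprMn (sqr_sqrtr (ltW eps_gt0)).
Qed.

Context {dO dS : measure_display} {Omega : measurableType dO} {S : measurableType dS}.
Variables (P : probability Omega R) (Q : probability S R).
Variable solve : 'cV[R]_n.+1 -> S -> 'cV[R]_n.+1.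
Hypothesis msolve :
  measurable_fun setT (fun ys : 'cV[R]_n.+1 * S => solve ys.1 ys.2).
Hypothesis solve_err : forall y : 'cV[R]_n.+1,
  ('E_Q[fun s => mxnorm B (solve y s - invmx B *m y)%R] <= err%:E)%E.
Variables (x : {RV P >-> 'cV[R]_n.+1}) (seed : nat -> {RV P >-> S}).
Hypotheses (gauss_x : standard_gaussian P x) (ind : independent_seeds Q x seed).

Let iter t w := power_iterates solve (normalize (x w)) (seed ^~ w) t.
Let small_head := [set w | `|\sum_i v ord0 i 0 * x w i 0| <= (d ^+ 10)^-1].
(** Indexed by natural numbers to fit the union bound; [inord] is faithful on the indices below
    [n.+1]. *)
Let large_entry i :=
  [set w | Num.sqrt (30 * ln d) <= `|x w (inord i) 0|].
Let large_error t :=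
  [set w | thr <= mxnorm B (solve (iter t w) (seed t w) - invmx B *m iter t w)].

Lemma probability_small_head : (P small_head <= (expR (1 / 2) / d ^+ 10)%:E)%E.
Proof.
apply: gaussian_anticoncentration => //; first by rewrite invr_gt0 exprn_gt0.
have := eigcoord_basis eig ord0 ord0; rewrite eqxx /eigcoord mxE => vv.
by rewrite -[RHS]vv; apply: eq_bigr => i _; rewrite mxE expr2.
Qed.

(** The constant 30 makes the tail exponent [3 / 8 * 30 * ln d] at least [11 * ln d], which leaves a
    factor [d] for the union over the entries. *)
Lemma probability_large_entry i :
  (P (large_entry i) <= (2 / d ^+ 11)%:E)%E.
Proof.
case: gauss_x => _ lawx.
have := lawx (inord i) [set y | Num.sqrt (30 * ln d) <= `|y|].
rewrite /preimage /= => ->; last first.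
  by apply: measurable_set_ler => //; exact: normr_measurable.
apply: (le_trans (normal_tail_le (sqrtr_ge0 _))); rewrite lee_fin ler_wpM2l//.
have -> : (d ^+ 11)^-1 = expR (- (11 * ln d)) by rewrite expRN expRM_natl lnK.
rewrite (sqr_sqrtr (mulr_ge0 (ler0n _ 30) (ltW lnd))) ler_expR lerN2.
by move: lnd; lra.
Qed.

Lemma measurable_solve_error t : measurable_fun setT
  (fun w => mxnorm B (solve (iter t w) (seed t w) - invmx B *m iter t w)).
Proof.
have mi := measurable_random_iterates msolve x seed t.
apply: measurable_mxnorm; apply: measurable_submx.
  exact: (measurableT_comp msolve (measurable_fun_pair mi (measurable_funP (seed t)))).
exact: measurable_mulmx.
Qed.

Lemma probability_large_error t : (P (large_error t) <= (T%:R * d ^+ 10)^-1%:E)%E.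
Proof.
have -> : (T%:R * d ^+ 10)^-1 = err / thr.
  have := solve_error_gt0; rewrite /thr; move: (T%:R * d ^+ 10) err => u e e0.
  by rewrite [in RHS]invfM mulrCA divff ?mulr1// gt_eqF.
apply: (markov_ge0 (measurable_solve_error t) _ error_threshold_gt0) => [w|].
  exact: sqrtr_ge0.
pose g (ys : 'cV[R]_n.+1 * S) := mxnorm B (solve ys.1 ys.2 - invmx B *m ys.1).
have mg : measurable_fun setT g.
  by apply: measurable_mxnorm; apply: measurable_submx => //; exact: measurable_mulmx.
apply: (expectation_solve_error msolve ind t mg) => [z||y].
- exact: sqrtr_ge0.
- exact: ltW solve_error_gt0.
- by have := solve_err y; rewrite unlock.
Qed.

(** In units of [1 / d ^+ 10], the small head costs [expR (1 / 2)], the [d] entries cost 2 and the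
    [T] errors cost 1. *)
Lemma probability_success (c : R) : 0 < c ->
  101 / eps * (r / (d ^+ 10)^-1) ^+ 2 / 100 ^+ T + 9 * (2 * h / a) ^+ 2 <=
     c ^+ 2 * eps ->
  ((1 - (expR (1 / 2) + 3) / d ^+ 10)%:E <=
   P [set w | Gbar eps lam v B (iter T w) <= (c * Num.sqrt eps)%:E])%E.
Proof.
move=> c0 G; set E := [set w | _].
have mE : measurable E.
  by apply: measurable_Gbar_le; exact: measurable_random_iterates.
pose bad := small_head `|` \big[setU/set0]_(i < n.+1) large_entry i `|`
  \big[setU/set0]_(t < T) large_error t.
have mx i : measurable_fun setT (fun w => x w i 0) by apply: measurable_entry.
have msmall : measurable small_head.
  apply: measurable_set_ler => //; apply: measurableT_comp => //.
  by apply: measurable_sum => i; exact: measurable_funM.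
have mentry i : measurable (large_entry i).
  by apply: measurable_set_ler => //; exact: measurableT_comp.
have merror t : measurable (large_error t).
  by apply: measurable_set_ler => //; exact: measurable_solve_error.
have mU N (A : nat -> set Omega) : (forall i, measurable (A i)) ->
    measurable (\big[setU/set0]_(i < N) A i).
  by move=> mA; apply: bigsetU_measurable.
have sub : ~` E `<=` bad.
  apply: subsetCl => w nbad.
  have inU N (A : nat -> set Omega) i : (i < N)%N -> A i w ->
      (\big[setU/set0]_(i < N) A i) w.
    by move=> iN Aw; rewrite -bigcup_mkord; exists i.
  apply: Gbar_power_iterates_le => //.
  - rewrite leNgt; apply/negP => lt_; apply: nbad; left; left.
    rewrite /small_head /= (le_trans _ (ltW lt_))// /eigcoord mxE.
    by under [in leRHS]eq_bigr do rewrite mxE.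
  - move=> i; rewrite leNgt; apply/negP => lt_; apply: nbad; left; right.
    by apply: (inU _ _ i) => //; rewrite /large_entry /= inord_val ltW.
  - move=> t tT; rewrite leNgt; apply/negP => lt_; apply: nbad; right.
    by apply: (inU _ _ t) => //; rewrite /large_error /= ltW.
have Pbad : (P bad <= ((expR (1 / 2) + 3) / d ^+ 10)%:E)%E.
  have -> : (expR (1 / 2) + 3) / d ^+ 10 = expR (1 / 2) / d ^+ 10 +
      n.+1%:R * (2 / d ^+ 11) + T%:R * (T%:R * d ^+ 10)^-1.
    by rewrite -/d; field; rewrite pnatr_eq0 -lt0n T_gt0 /= gt_eqF.
  rewrite !EFinD; apply: (le_trans (measureU2 _ _ _)).
  - by apply: measurableU => //; exact: mU.
  - exact: mU.
  apply: leeD; last by apply: union_bound => // t _; exact: probability_large_error.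
  apply: (le_trans (measureU2 _ _ _)) => //; first exact: mU.
  apply: leeD; first exact: probability_small_head.
  by apply: union_bound => // i _; exact: probability_large_entry.
have mbad : measurable bad.
  by apply: measurableU; [apply: measurableU => //|]; exact: mU.
have : (P (~` E) <= P bad)%E.
  by apply: le_measure => //; rewrite inE//; exact: measurableC.
move=> /le_trans/(_ Pbad); rewrite probability_setC//.
have PE : P E \is a fin_num by exact: fin_num_measure.
by rewrite -(fineK PE) -EFinB !lee_fin => ?; rewrite lerBlDr addrC -lerBlDr.
Qed.

End success.

(** * Choice of the constants and of the number of steps *)

Theorem theorem8p2 (R : realType) (c : R) (hc : 0 < c) :
  exists K1 K2 : R, [/\ 0 < K1, 0 < K2 &
  forall (n : nat) (eps : R), 0 < eps -> eps < 1 ->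
  let d := n.+1 in
  exists T : nat, T%:R <= K1 * ln (d%:R / eps) /\
  forall (Sigma : 'M[R]_d) (lam : 'I_d -> R) (v : 'I_d -> 'cV[R]_d),
  Sigma^T = Sigma -> psd Sigma -> eigensystem Sigma lam v -> 0 < lam ord0 ->
  let B := shifted_mx eps lam Sigma in
  forall (dS : measure_display) (S : measurableType dS) (Q : probability S R)
    (solve : 'cV[R]_d -> S -> 'cV[R]_d),
  measurable_fun setT (fun ys : 'cV[R]_d * S => solve ys.1 ys.2) ->
  (forall y : 'cV[R]_d,
     ('E_Q[fun s => mxnorm B (solve y s - invmx B *m y)%R] <=
      (eps ^+ 3 / (3000 * d%:R ^+ 21)
         * Num.sqrt (eig_inv eps lam ord_max))%:E)%E) ->
  forall (dO : measure_display) (Omega : measurableType dO)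
    (P : probability Omega R)
    (x : {RV P >-> 'cV[R]_d}) (seed : nat -> {RV P >-> S}),
  standard_gaussian P x -> independent_seeds Q x seed ->
  ((1 - K2 / d%:R ^+ 10)%:E <
   P [set w | Gbar eps lam v B
                (power_iterates solve (normalize (x w)) (seed ^~ w) T)
              <= (c * Num.sqrt eps)%:E])%E].
Proof.
have [D D1 par] := iteration_parameters hc.
have D0 : 0 <= D by exact: le_trans D1.
(* The summand [D ^+ 10] forces [D <= d] as soon as [K2 <= d ^+ 10]; the 4, one more than the
   failure bound requires, makes the final inequality strict. *)
pose K2 := D ^+ 10 + (expR (1 / 2) + 4).
have K0 : 0 < expR (1 / 2) + 4 :> R by rewrite addr_gt0 ?expR_gt0.
exists 24, K2; split => //; first by rewrite ltr_wpDl ?exprn_ge0.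
move=> n eps e0 e1 d.
have d0 : 0 < d%:R ^+ 10 :> R by rewrite exprn_gt0// ltr0n.
have L0 : 0 <= 24 * ln (d%:R / eps).
  rewrite mulr_ge0// ln_ge0// ler_pdivlMr// mul1r (le_trans (ltW e1))//.
  by rewrite ler1n.
have /andP[Tle Tgt] := truncn_itv L0.
exists (Num.truncn (24 * ln (d%:R / eps))); split => //.
move=> Sigma lam v Ssym Spsd eig lam0 B dS S Q solve msolve err.
move=> dO Omega P x seed gx ind.
have [small|large] := ltP (d%:R ^+ 10) K2.
  (* In small dimensions the claimed lower bound is negative. *)
  by apply: lt_le_trans (measure_ge0 P _); rewrite lte_fin subr_lt0 ltr_pdivlMr// mul1r.
have Dd : D <= d%:R.
  rewrite -(@ler_pXn2r _ 10)// ?nnegrE//; apply: le_trans large.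
  by rewrite lerDl ltW.
have [T0 lnd Tha G] := par _ _ _ Dd e0 e1 Tle Tgt.
have := probability_success e0 e1 lam0 Ssym Spsd eig T0 lnd Tha msolve err gx ind hc G.
apply: lt_le_trans; rewrite lte_fin ltrD2l ltrN2 ltr_pM2r ?invr_gt0//.
apply: (@lt_le_trans _ _ (expR (1 / 2) + 4)); first by rewrite ltrD2l ltr_nat.
by rewrite lerDr exprn_ge0.
Qed.
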